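(* Let $q>1$, $\zeta,\eta\in\mathbb{T}$ and $\lambda\in\mathbb{C}$ with $|\lambda|=1$. Then $$\ker\big(Q_{q,\zeta,\eta}-\lambda I:L^1((0,1))\to L^1((0,1))\big)=\begin{cases}\mathbb{C}\rho_q,&(\zeta,\eta,\lambda)=(1,1,1),\\ \{0\},&\text{otherwise}.\end{cases}$$
   Context: $\mathbb{T}=\{z\in\mathbb{C}:|z|=1\}$. For $\omega\in\mathbb{T}$ and $h\in L^1((0,1))$ (extended by zero outside $(0,1)$), $$(\mathcal{L}_{\omega,q}h)(x)=\sum_{n\ge1}\omega^n\frac{q}{(n+x)^2}h\Big(\frac{q}{n+x}\Big),\quad 0<x<1,$$ and $Q_{q,\zeta,\eta}=\mathcal{L}_{\zeta,q}\mathcal{L}_{\eta,q}$. $\rho_q$ is the unique function in $BV((0,1))$ with $\mathcal{L}_{1,q}\rho_q=\rho_q$, $\rho_q>0$ a.e. and $\int_0^1\rho_q\,dx=1$. *)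

(* Defs.v *)
From HB Require Import structures.
From mathcomp Require Import all_boot all_order all_algebra.
From mathcomp Require Import all_classical all_reals all_analysis.
From mathcomp Require Import complex.

Set Implicit Arguments.
Unset Strict Implicit.
Unset Printing Implicit Defensive.

Import Order.TTheory GRing.Theory Num.Theory.
Import numFieldNormedType.Exports.

Local Open Scope classical_set_scope.
Local Open Scope ring_scope.
Local Open Scope complex_scope.

Section defs.
Context {R : realType}.

Local Notation mu := (@lebesgue_measure R).

Definition I01 : set R := `]0, 1[.

(* Elements of L^1((0,1)) are represented by functions R -> R[i]; only their
   values on (0,1) matter, and equality in L^1((0,1)) is [ae01]. *)
Definition ae01 {V : Type} (f g : R -> V) : Prop :=
  f = g %[ae mu in I01].

Definition L1 (h : R -> R[i]) : Prop :=
  mu.-integrable I01 (fun x => (complex.Re (h x))%:E) /\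
  mu.-integrable I01 (fun x => (complex.Im (h x))%:E).

(* The series is the limit of its partial sums in R[i] (with its norm
   topology); for h in L^1((0,1)) it converges absolutely for almost every x
   in (0,1), and its value elsewhere is irrelevant up to [ae01]. *)
Definition transfer (w : R[i]) (q : R) (h : R -> R[i]) (x : R) : R[i] :=
  \big[+%R/0]_(1 <= n <oo)
    (w ^+ n * (q / (n%:R + x) ^+ 2)%:C
      * patch (fun=> 0) I01 h (q / (n%:R + x)) : R[i]^o).

Definition Q (q : R) (zeta eta : R[i]) (h : R -> R[i]) : R -> R[i] :=
  transfer zeta q (transfer eta q h).

Definition kerQ (q : R) (zeta eta lambda : R[i]) : set (R -> R[i]) :=
  [set h | L1 h /\ ae01 (fun x => Q q zeta eta h x - lambda * h x) (fun=> 0)].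

Definition Cspan (f : R -> R[i]) : set (R -> R[i]) :=
  [set h | L1 h /\ exists c : R[i], ae01 h (fun x => c * f x)].

Definition L1zero : set (R -> R[i]) := [set h | L1 h /\ ae01 h (fun=> 0)].

(* Membership of the a.e. class of f in BV((0,1)): some representative has
   bounded total variation over the compact subintervals of the open
   interval (0,1), uniformly. *)
Definition BV01 (f : R -> R) : Prop :=
  exists g : R -> R, ae01 f g /\
    exists M : R, forall a b : R, 0 < a -> a <= b -> b < 1 ->
      (total_variation a b g <= M%:E)%E.

(* The properties characterizing rho_q.  It is taken real-valued, as is forced
   (a.e.) by its positivity; integrability excludes non-measurable
   representatives. *)
Definition is_rho (q : R) (rho : R -> R) : Prop :=
  [/\ mu.-integrable I01 (fun x => (rho x)%:E),
      BV01 rho,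
      ae01 (transfer 1 q (fun x => (rho x)%:C)) (fun x => (rho x)%:C),
      {ae mu, forall x, I01 x -> 0 < rho x} &
      (\int[mu]_(x in I01) (rho x)%:E = 1)%E].

End defs.

(* Main.v *)
Require Import Defs.
From HB Require Import structures.
From mathcomp Require Import all_boot all_order all_algebra.
From mathcomp Require Import all_classical all_reals all_analysis.
From mathcomp Require Import complex ring lra measurable_realfun.

Set Implicit Arguments.
Unset Strict Implicit.
Unset Printing Implicit Defensive.

Import Order.TTheory GRing.Theory Num.Theory.
Import numFieldNormedType.Exports.

Local Open Scope classical_set_scope.
Local Open Scope ring_scope.
Local Open Scope complex_scope.

(** Write T for the map y |-> q / y mod 1 of (0,1).  Its inverse branches are
    x |-> q / (n + x), and the transfer operators are its Perron-Frobenius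
    operator twisted by the phases w^n.  Since q > 1, T is expanding.

    No cancellation.  Let Q h = lambda h with |lambda| = 1.  Then |h| is at
    most the untwisted operator applied twice to |h|, and both functions have
    the same integral (integral_pf), so they agree almost everywhere.  Hence
    the triangle inequality is an equality in both series defining Q h, and the
    phase of h at a point reached from x through the branches m and n is the
    phase of h at x multiplied by lambda / (zeta^m eta^n) (phase_relation).
    Iterating, the phase along every branch of an even power of T is, up to a
    constant factor, the phase at x (word_relation).

    Spreading.  Unless h vanishes, there is a Lebesgue point y of its phase
    with h y <> 0 (regular_point), and near y the phase is nearly constant in
    mean.  Compositions of branches are Moebius maps whose derivative varies
    by a factor at most 4 on [0,1] (word_weight_distortion).  So if such a
    composition maps all of (0,1) into (0,1) and its image is a place where
    the mean deviation from the phase at y is small (concentrating_word), then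
    pulling back shows that the phase is nearly constant on (0,1)
    (phase_approx), hence constant (phase_constant).

    The image intervals of these compositions, the full cylinders, do exist
    near y in the sense required: if the mean of a nonnegative function over
    every full cylinder is at least delta, then its mean over every interval is
    at least a fixed multiple of delta (interval_lower_bound).  To see this,
    follow an interval under T.  As long as it lies in one branch domain it
    grows.  When it contains a discontinuity q / n, cut it there.  The left
    part is largely made of full branch domains, or becomes so after one more
    step, where it has the form (0,e).  The right part either is at most a
    fixed multiple of the left part, or is longer than it by such a factor that
    its image exceeds the whole interval by the factor 2 q / (q + 1) > 1; in
    that case it is followed further, which can happen only finitely often.
    The branch domain adjacent to 1 is incomplete when q is not an integer, but
    it occurs only as part of the interval being followed.

    Conclusion.  A constant phase forces lambda = zeta^m eta^n for all large m
    and n, so zeta = eta = lambda = 1 (trivial_characters).  In that case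
    h - t rho, with t the integral of h, is an eigenfunction of integral zero;
    having constant phase, it vanishes (ae_zero_of_integral_zero), which shows
    that the kernel is spanned by rho (kerQ_rho). *)

(** * Change of variables along weighted maps *)

Section transport.
Context d d' (T : measurableType d) (U : measurableType d') {R : realType}.
Variables (mu : {measure set T -> \bar R}) (nu : {measure set U -> \bar R}).

Import HBNNSimple.

(** Both sides are monotone and additive in [F] and commute with increasing
    limits, so the formula for indicators, assumed here for subsets of [E],
    extends to simple functions and then to all nonnegative [F]. *)
Lemma ge0_integral_transport (D : set T) (E : set U) (w : T -> R) (y : T -> U)
    (F : U -> \bar R) :
  measurable D -> measurable E ->
  (forall x, D x -> 0 <= w x) -> measurable_fun D w ->
  measurable_fun D y -> (forall x, D x -> E (y x)) ->
  (forall A, measurable A -> A `<=` E ->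
     nu A = (\int[mu]_(x in D) (w x * \1_A (y x))%:E)%E) ->
  measurable_fun E F -> (forall z, E z -> (0 <= F z)%E) ->
  (\int[nu]_(z in E) F z = \int[mu]_(x in D) ((w x)%:E * F (y x)))%E.
Proof.
move=> mD mE w0 mw my DE muE mF F0.
pose h := nnsfun_approx mE mF.
have mhy n : measurable_fun D (fun x => h n (y x)).
  by apply: (@measurable_comp _ _ _ _ _ _ setT).
transitivity (limn (fun n => \int[nu]_(z in E) (h n z)%:E)%E).
  rewrite -monotone_convergence//.
  - apply: eq_integral => z /[!inE] zE; apply/esym/cvg_lim => //.
    exact: cvg_nnsfun_approx.
  - by move=> n; apply/measurable_EFinP; exact: measurable_funP.
  - by move=> n z _; rewrite lee_fin.
  - by move=> z _ m n mn; rewrite lee_fin; exact/lefP/nd_nnsfun_approx.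
transitivity (limn (fun n => \int[mu]_(x in D) ((w x)%:E * (h n (y x))%:E))%E); last first.
  rewrite -monotone_convergence//.
  - apply: eq_integral => x /[!inE] xD; apply/cvg_lim => //.
    apply: cvgeZl => //.
    by apply: cvg_nnsfun_approx => //; exact: DE.
  - move=> n; apply: emeasurable_funM; apply/measurable_EFinP => //.
  - by move=> n x Dx; rewrite mule_ge0 ?lee_fin ?w0.
  - move=> x Dx m n mn; rewrite lee_wpmul2l ?lee_fin ?w0//.
    exact/lefP/nd_nnsfun_approx.
congr (limn _); apply/funext => n.
transitivity (\sum_(r \in range (h n))
    \int[nu]_(z in E) (r * \1_(h n @^-1` [set r]) z)%:E)%E.
  under eq_integral do rewrite fimfunE -fsumEFin//.
  rewrite ge0_integral_fsum//.
  - move=> r; apply/measurable_EFinP; apply: measurable_funM => //.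
  - by move=> r x _; rewrite nnfun_muleindic_ge0.
transitivity (\sum_(r \in range (h n))
    \int[mu]_(x in D) ((w x)%:E * (r * \1_(h n @^-1` [set r]) (y x))%:E))%E; last first.
  rewrite -ge0_integral_fsum//.
  - apply: eq_integral => x xD.
    rewrite -ge0_mule_fsumr; last by move=> r; exact: nnfun_muleindic_ge0.
    by rewrite fsumEFin// -fimfunE.
  - move=> r; apply: emeasurable_funM; apply/measurable_EFinP => //.
    apply: measurable_funM => //.
    apply: (@measurable_comp _ _ _ _ _ _ setT) => //.
  - by move=> r x Dx; rewrite mule_ge0 ?lee_fin ?w0// -lee_fin nnfun_muleindic_ge0.
apply: eq_fsbigr => r rh.
have r0 : 0 <= r by move: rh; rewrite inE => -[z _ <-].
have mA : measurable (h n @^-1` [set r]) by [].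
under eq_integral do rewrite EFinM.
rewrite ge0_integralZl_EFin//; last first.
  by apply/measurable_EFinP.
rewrite integral_indic//= muE; last 2 first.
- exact: measurableI.
- by apply: subIsetr.
rewrite -ge0_integralZl_EFin//; last 2 first.
- by move=> x Dx; rewrite lee_fin mulr_ge0 ?w0.
- apply/measurable_EFinP; apply: measurable_funM => //.
  apply: (@measurable_comp _ _ _ _ _ _ setT) => //.
  by apply: measurable_indic; exact: measurableI.
apply: eq_integral => x /[!inE] xD.
rewrite -!EFinM indicI/=.
have -> : \1_E (y x) = 1 :> R by rewrite indicE mem_set//; exact: DE.
by rewrite mulr1; congr EFin; ring.
Qed.

End transport.

(** * Inverse branches of x |-> q / x mod 1 *)

Section branch.
Context {R : realType} (q : R).
Hypothesis q0 : 0 < q.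
Implicit Types (n : nat) (x y z a b : R).
Local Notation mu := (@lebesgue_measure R).

Definition branch (n : nat) (x : R) := q / (n%:R + x).
Definition branch_weight (n : nat) (x : R) := q / (n%:R + x) ^+ 2.

Lemma natr_gt0 (n : nat) : (0 < n)%N -> 0 < n%:R :> R.
Proof. by rewrite ltr0n. Qed.

Lemma branch_gt0 n x : (0 < n)%N -> 0 <= x -> 0 < branch n x.
Proof. by move=> n0 x0; rewrite divr_gt0// ltr_wpDr// ltr0n. Qed.

Lemma branch_weight_gt0 n x : (0 < n)%N -> 0 <= x -> 0 < branch_weight n x.
Proof. by move=> n0 x0; rewrite divr_gt0// exprn_gt0// ltr_wpDr// ltr0n. Qed.

Lemma branch_itv n x a b : (0 < n)%N -> 0 <= x -> 0 <= a -> 0 <= b ->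
  (branch n b < branch n x < branch n a) = (a < x < b).
Proof.
move=> n0 x0 a0 b0; have n0' := natr_gt0 n0.
have P (y : R) : 0 <= y -> 0 < n%:R + y by move=> y0; exact: ltr_wpDr.
by rewrite /branch !ltr_pM2l// !ltf_pV2 ?posrE ?P// !ltrD2l andbC.
Qed.

Lemma branch_ltE n x z : (0 < n)%N -> 0 <= x -> 0 < z ->
  (branch n x < z) = (q / z - n%:R < x).
Proof.
move=> n0 x0 z0; have n0' := natr_gt0 n0.
rewrite /branch ltr_pdivrMr ?ltr_wpDr// ltrBlDl ltr_pdivrMr//.
by rewrite [in RHS]mulrC.
Qed.

Lemma branch_leE n x z : (0 < n)%N -> 0 <= x -> 0 < z ->
  (branch n x <= z) = (q / z - n%:R <= x).
Proof.
move=> n0 x0 z0; have n0' := natr_gt0 n0.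
rewrite /branch ler_pdivrMr ?ltr_wpDr// lerBlDl ler_pdivrMr//.
by rewrite [in RHS]mulrC.
Qed.

Lemma branch_gtE n x z : (0 < n)%N -> 0 <= x -> 0 < z ->
  (z < branch n x) = (x < q / z - n%:R).
Proof. by move=> n0 x0 z0; rewrite ltNge branch_leE// -ltNge. Qed.

Lemma branch_geE n x z : (0 < n)%N -> 0 <= x -> 0 < z ->
  (z <= branch n x) = (x <= q / z - n%:R).
Proof. by move=> n0 x0 z0; rewrite leNgt branch_ltE// -leNgt. Qed.

Lemma continuous_branch n x : (0 < n)%N -> 0 <= x -> {for x, continuous (branch n)}.
Proof.
move=> n0 x0; have n0' := natr_gt0 n0.
apply: (@continuousM R R (cst q)); first exact: cvg_cst.
apply: continuousV; first by rewrite gt_eqF// ltr_wpDr.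
by apply: continuousD; [exact: cvg_cst|exact: cvg_id].
Qed.

Lemma continuous_branch_weight n x : (0 < n)%N -> 0 <= x -> {for x, continuous (branch_weight n)}.
Proof.
move=> n0 x0; have n0' := natr_gt0 n0.
apply: (@continuousM R R (cst q)); first exact: cvg_cst.
apply: continuousV; first by rewrite gt_eqF// exprn_gt0// ltr_wpDr.
have cn : {for x, continuous (fun x : R => n%:R + x)}.
  by apply: continuousD; [exact: cvg_cst|exact: cvg_id].
exact: (continuousM cn cn).
Qed.

Lemma measurable_branch n (D : set R) : (0 < n)%N -> measurable D ->
  (forall x, D x -> 0 <= x) -> measurable_fun D (branch n).
Proof.
move=> n0 mD D0.
have : measurable_fun (`[0, +oo[%classic : set R) (branch n).
  apply: subspace_continuous_measurable_fun => //.
  apply: continuous_in_subspaceT => x.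
  by rewrite inE/= in_itv/= andbT => x0; exact: continuous_branch.
by apply: measurable_funS => // x /D0 /=; rewrite in_itv/= andbT.
Qed.

Lemma measurable_branch_weight n (D : set R) : (0 < n)%N -> measurable D ->
  (forall x, D x -> 0 <= x) -> measurable_fun D (branch_weight n).
Proof.
move=> n0 mD D0.
have : measurable_fun (`[0, +oo[%classic : set R) (branch_weight n).
  apply: subspace_continuous_measurable_fun => //.
  apply: continuous_in_subspaceT => x.
  by rewrite inE/= in_itv/= andbT => x0; exact: continuous_branch_weight.
by apply: measurable_funS => // x /D0 /=; rewrite in_itv/= andbT.
Qed.

Lemma is_derive_branch n x : (0 < n)%N -> 0 <= x ->
  is_derive x 1 (fun x => - branch n x) (branch_weight n x).
Proof.
move=> n0 x0; have n0' := natr_gt0 n0.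
have nx0 : n%:R + x != 0 by rewrite gt_eqF// ltr_wpDr.
rewrite /branch /branch_weight.
have H1 : is_derive x 1 (fun x => n%:R + x) (1 : R).
  by apply: is_derive_eq; rewrite add0r mulr1.
have := @is_deriveV _ (fun x => n%:R + x) x 1 _ nx0 H1.
move=> H2.
have := @is_deriveZ _ _ _ (fun x => (n%:R + x)^-1) (- q) x 1 _ H2.
rewrite /= => H3.
rewrite (_ : (fun x => _) = (- q \*: (fun x => (n%:R + x)^-1))); last first.
  by apply/funext => y; rewrite -mulNr.
apply: is_derive_eq.
rewrite /GRing.scale/=; field.
exact: nx0.
Qed.

Lemma integral_branch_weight n a b : (0 < n)%N -> 0 <= a -> a <= b ->
  (\int[mu]_(x in `]a, b[) (branch_weight n x)%:E = (branch n a - branch n b)%:E)%E.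
Proof.
move=> n0 a0; rewrite le_eqVlt => /predU1P[->|ab].
  by rewrite set_itvoo0// integral_set0 subrr.
rewrite -(@integral_itv_bndoo _ _ _ _ true false); last first.
  apply/measurable_EFinP; apply: measurable_branch_weight => // x /=.
  by rewrite in_itv/= => /andP[/ltW ax _]; exact: le_trans ax.
rewrite (@continuous_FTC2 _ _ (fun x => - branch n x))//.
- by rewrite -EFinB; congr EFin; ring.
- apply: continuous_in_subspaceT => x.
  rewrite inE/= in_itv/= => /andP[ax _].
  by apply: continuous_branch_weight => //; exact: le_trans ax.
- split.
  + move=> x; rewrite in_itv/= => /andP[/ltW ax _].
    by apply: ex_derive; apply: is_derive_branch => //; exact: le_trans ax.
  + apply: cvg_at_right_filter; apply: continuousN; exact: continuous_branch.
  + apply: cvg_at_left_filter; apply: continuousN; apply: continuous_branch => //.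
    by rewrite (le_trans a0)// ltW.
- move=> x; rewrite in_itv/= => /andP[/ltW ax _]; rewrite derive1E.
  by apply: derive_val; apply: is_derive_branch => //; exact: le_trans ax.
Qed.

End branch.

Section squeeze.
Context {R : realType}.
Local Notation mu := (@lebesgue_measure R).

(** Preimages of half-open intervals under a decreasing branch are intervals
    closed at the other end, possibly cut by the domain; the two lemmas below
    make the end points irrelevant. *)
Lemma ge0_integral_itv_squeeze (a b : R) (S : set R) (f : R -> \bar R) :
  measurable S -> `]a, b[ `<=` S -> S `<=` `[a, b] ->
  measurable_fun (`[a, b] : set R) f ->
  (forall x, a <= x <= b -> (0 <= f x)%E) ->
  (\int[mu]_(x in S) f x = \int[mu]_(x in `]a, b[) f x)%E.
Proof.
move=> mS abS Sab mf f0.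
have f0' x : x \in `[a, b] -> (0 <= f x)%E by rewrite in_itv; exact: f0.
apply/eqP; rewrite eq_le; apply/andP; split.
- rewrite -(@integral_itv_bndoo _ _ _ _ true false); last first.
    by apply: measurable_funS mf => //; exact: subset_itv_oo_cc.
  by apply: ge0_subset_integral => //.
- apply: ge0_subset_integral => //; first exact: measurable_funS mf.
  by move=> x /Sab; exact: f0'.
Qed.

Lemma lebesgue_itv_squeeze (a b : R) (S : set R) :
  a <= b -> measurable S -> `]a, b[ `<=` S -> S `<=` `[a, b] ->
  mu S = (b - a)%:E.
Proof.
move=> ab mS abS Sab.
have E c d : mu [set` Interval (BSide c a) (BSide d b)] = (b - a)%:E.
  rewrite lebesgue_measure_itv/= lte_fin.
  by move: ab; rewrite le_eqVlt => /predU1P[->|->]; rewrite ?ltxx ?subrr// EFinB.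
apply/eqP; rewrite eq_le -{1}(E true false) -(E false true).
by rewrite !le_measure ?inE.
Qed.

End squeeze.

Section branch_measure.
Context {R : realType} (q : R).
Hypothesis q0 : 0 < q.
Local Notation mu := (@lebesgue_measure R).
Variables (n : nat) (a b : R).
Hypotheses (n0 : (0 < n)%N) (a0 : 0 <= a) (ab : a <= b).

Local Notation D := (`]a, b[%classic : set R).
Local Notation E := (`](branch q n b), (branch q n a)[%classic : set R).

Let D0 x : D x -> 0 <= x.
Proof. by rewrite /= in_itv/= => /andP[/ltW ax _]; exact: le_trans ax. Qed.

Let b0 : 0 <= b. Proof. exact: le_trans ab. Qed.

Let DE x : D x -> E (branch q n x).
Proof. by move=> Dx; rewrite /= in_itv/= branch_itv// ?D0//; move: Dx; rewrite /= in_itv. Qed.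

Let mpre (A : set (measurableTypeR R)) : measurable A -> measurable (D `&` branch q n @^-1` A).
Proof. by move=> mA; apply: measurable_branch => //. Qed.

Let mjac : measurable_fun D (EFin \o branch_weight q n).
Proof. by apply/measurable_EFinP; apply: measurable_branch_weight => //. Qed.

Let nu (A : set (measurableTypeR R)) : \bar R :=
  (\int[mu]_(x in D `&` branch q n @^-1` A) (branch_weight q n x)%:E)%E.

Let nu0 : nu set0 = 0%E.
Proof. by rewrite /nu preimage_set0 setI0 integral_set0. Qed.

Let jac_ge0 A x : (D `&` A) x -> (0 <= (branch_weight q n x)%:E)%E.
Proof. by move=> [/D0 x0 _]; rewrite lee_fin ltW// branch_weight_gt0. Qed.

Let nu_ge0 A : (0 <= nu A)%E.
Proof. by rewrite /nu integral_ge0// => x; exact: jac_ge0. Qed.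

Let nu_sigma_additive : semi_sigma_additive nu.
Proof.
move=> F mF tF mUF.
rewrite /nu preimage_bigcup setI_bigcupr ge0_integral_bigcup//; last 4 first.
- by move=> k; have := mpre (mF k); apply.
- by apply: measurable_funS mjac => // x [k _ []].
- by move=> x [k _]; exact: jac_ge0.
- apply/trivIsetP => i j _ _ ij; rewrite -subset0 => x [[_ Fi] [_ Fj]].
  have : (F i `&` F j) (branch q n x) by [].
  by move/trivIsetP : tF => ->.
apply: is_cvg_ereal_nneg_natsum_cond => k _ _.
by apply: integral_ge0 => x; exact: jac_ge0.
Qed.

(** By uniqueness of Lebesgue measure: the right-hand side is a measure of [A],
    and adding to it Lebesgue measure off the image [E] gives a measure on the
    whole line with the right value on half-open intervals. *)
Lemma lebesgue_measure_branch (A : set R) : measurable A -> A `<=` E ->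
  mu A = (\int[mu]_(x in D) (branch_weight q n x * \1_A (branch q n x))%:E)%E.
Proof.
move=> mA AE.
pose nu' : {measure set (measurableTypeR R) -> \bar R} :=
  HB.pack nu (isMeasure.Build _ _ _ nu nu0 nu_ge0 nu_sigma_additive).
have mE : measurable (~` E : set (measurableTypeR R)) by exact: measurableC.
transitivity (measure_add nu' (mrestr mu mE) A); last first.
  rewrite measure_addE/= /mrestr.
  rewrite (_ : A `&` ~` E = set0); last by rewrite -setDE setD_eq0.
  rewrite measure0 adde0 /nu [LHS]integral_mkcondr; apply: eq_integral => x _.
  rewrite patchE/= indicE; case: ifPn => xA; rewrite ?mulr1 ?mulr0//.
    by rewrite (_ : _ \in A = true) ?mulr1//; move: xA; rewrite !inE.
  rewrite (_ : _ \in A = false) ?mulr0//; apply: contraNF xA.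
  by rewrite !inE.
apply: lebesgue_measure_unique => // _ [[c d]] _ <-.
change (mu `]c, d]%classic = measure_add nu' (mrestr mu mE) `]c, d]%classic).
rewrite measure_addE/= /mrestr -setDE.
rewrite (@measureDI _ _ _ mu `]c, d]%classic E)// addeC; congr (_ + _)%E.
pose c' := Num.max c (branch q n b); pose d' := Num.min d (branch q n a).
have bb0 : 0 < branch q n b by exact: branch_gt0.
have ab0 : 0 < branch q n a by exact: branch_gt0.
have XE x : (`]c, d] `&` E) x -> c' < x <= d'.
  rewrite /= !in_itv/= => -[/andP[cx xd] /andP[bx xa]].
  by rewrite gt_max le_min cx bx xd ltW.
have [cd'|dc'] := ltP c' d'; last first.
  rewrite (_ : `]c, d] `&` E = set0); last first.
    by rewrite -subset0 => x /XE /andP[/lt_le_trans /[apply]]; rewrite ltNge dc'.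
  rewrite measure0 /nu (_ : D `&` _ = set0) ?integral_set0//.
  rewrite -subset0 => x [/DE Ex Xx].
  have /XE/andP[/lt_le_trans /[apply]] : (`]c, d] `&` E) (branch q n x) by [].
  by rewrite ltNge dc'.
have c'0 : 0 < c' by rewrite lt_max bb0 orbT.
have d'0 : 0 < d' by exact: lt_trans cd'.
transitivity (d' - c')%:E.
  apply: lebesgue_itv_squeeze.
- exact: ltW.
- exact: measurableI.
- move=> x; rewrite /= !in_itv/= gt_max lt_min => /andP[/andP[-> ->] /andP[xd ->]].
  by rewrite ltW.
- by move=> x /XE /andP[/ltW c'x xd']; rewrite /= in_itv/= c'x.
pose x1 := q / d' - n%:R; pose x2 := q / c' - n%:R.
have brE y : 0 < y -> branch q n (q / y - n%:R) = y.
  by move=> y0; rewrite /branch addrC subrK; field; rewrite !gt_eqF.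
have x12 : x1 <= x2.
  by rewrite lerD2r ler_pM2l// lef_pV2 ?posrE// ltW.
have ax1 : a <= x1.
  by rewrite -branch_geE//; rewrite ge_min lexx orbT.
have x2b : x2 <= b.
  by rewrite -branch_leE// le_max lexx orbT.
have x10 : 0 <= x1 by exact: le_trans ax1.
rewrite /nu (@ge0_integral_itv_squeeze _ x1 x2).
- by rewrite integral_branch_weight// !brE.
- by have := @mpre `]c, d]%classic (measurable_itv _); apply.
- move=> x; rewrite /= !in_itv/= => /andP[x1x xx2].
  have x0 : 0 <= x by rewrite (le_trans x10)// ltW.
  rewrite (le_lt_trans ax1 x1x) (lt_le_trans xx2 x2b); split=> //.
  move: x1x xx2; rewrite /x1 /x2 -branch_ltE// -branch_gtE//.
  by rewrite gt_max lt_min => /andP[/ltW -> _] /andP[-> _].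
- move=> x [Dx Xx]; have x0 := D0 Dx.
  have /XE/andP[/ltW c'x xd'] : (`]c, d] `&` E) (branch q n x) by split => //; exact: DE.
  by rewrite /= in_itv/= /x1 /x2 -branch_leE// -branch_geE// xd' c'x.
- apply/measurable_EFinP; apply: measurable_branch_weight => // x /=.
  by rewrite in_itv/= => /andP[+ _]; exact: le_trans.
- by move=> x /andP[x1x _]; rewrite lee_fin ltW// branch_weight_gt0//; exact: le_trans x1x.
Qed.

Lemma integral_branch (F : R -> \bar R) :
  measurable_fun E F -> (forall z, E z -> (0 <= F z)%E) ->
  (\int[mu]_(z in E) F z = \int[mu]_(x in D) ((branch_weight q n x)%:E * F (branch q n x)))%E.
Proof.
move=> mF F0; apply: ge0_integral_transport => //.
- by move=> x /D0 x0; rewrite ltW// branch_weight_gt0.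
- by apply: measurable_branch_weight.
- by apply: measurable_branch.
- exact: lebesgue_measure_branch.
Qed.

End branch_measure.

(** * Compositions of branches *)

Section words.
Context {R : realType} (q : R).
Hypothesis q0 : 0 < q.
Local Notation mu := (@lebesgue_measure R).
Implicit Types (n : nat) (s : seq nat) (x y z a b c : R).

Local Notation br := (branch q).
Local Notation jac := (branch_weight q).

(** The head of a word is the branch applied first, that is, the innermost one.
    The weight of a word is the absolute value of the derivative of its map.
    Validity keeps all intermediate points in (0,1), where the functions under
    consideration live and their zero extension does not interfere. *)
Fixpoint word_map s x := if s is n :: s' then word_map s' (br n x) else x.
Fixpoint word_weight s x := if s is n :: s' then jac n x * word_weight s' (br n x) else 1.
Fixpoint word_valid s x :=
  if s is n :: s' then [&& (0 < n)%N, br n x < 1 & word_valid s' (br n x)] else true.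
Local Notation pos := (all (fun n => 0 < n)%N).

(** The map of a word is a Moebius map, so its derivative is a constant over a
    squared linear form.  The inequality between the coefficients, which bounds
    the distortion, is preserved because every letter is at least 1. *)
Lemma word_weight_mobius s : pos s -> exists A c d, [/\ 0 < A, 0 <= c <= d, 0 < d &
  forall x, 0 <= x -> word_weight s x = A / (c * x + d) ^+ 2].
Proof.
elim: s => [_|n s IH /= /andP[n0 /IH[A [c [d [A0 /andP[c0 cd] d0 E]]]]]].
  exists 1, 0, 1; split; rewrite ?lexx ?ler01// => x _ /=.
  by rewrite mul0r add0r expr1n divr1.
have n0' := @natr_gt0 R n n0.
have n1 : 1 <= n%:R :> R by rewrite ler1n.
exists (q * A), d, (c * q + d * n%:R); split.
- exact: mulr_gt0.
- by rewrite (ltW d0)/= -[leLHS]add0r lerD ?mulr_ge0 ?ler_peMr// ltW.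
- by rewrite ltr_wpDl ?mulr_ge0 ?mulr_gt0// ltW.
move=> x x0; rewrite E; last by rewrite ltW// branch_gt0.
rewrite /branch_weight /branch; have nx : 0 < n%:R + x by exact: ltr_wpDr.
have dx : 0 < d * x + (c * q + d * n%:R).
  by rewrite ltr_wpDl ?mulr_ge0 ?(ltW d0)// ltr_wpDl ?mulr_ge0 ?mulr_gt0// ltW.
have cx : 0 < c * (q / (n%:R + x)) + d by rewrite ltr_wpDl// mulr_ge0// ltW// divr_gt0.
by field; rewrite !gt_eqF.
Qed.

Lemma word_weight_gt0 s x : pos s -> 0 <= x -> 0 < word_weight s x.
Proof.
move=> /word_weight_mobius[A [c [d [A0 /andP[c0 cd] d0 E]]]] x0.
by rewrite E// divr_gt0// exprn_gt0// ltr_wpDl// mulr_ge0.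
Qed.

Lemma word_weight_decr s x y : pos s -> 0 <= x -> x <= y -> word_weight s y <= word_weight s x.
Proof.
move=> /word_weight_mobius[A [c [d [A0 /andP[c0 cd] d0 E]]]] x0 xy.
have y0 : 0 <= y by exact: le_trans xy.
have P z : 0 <= z -> 0 < c * z + d by move=> z0; rewrite ltr_wpDl// mulr_ge0.
rewrite !E// ler_pM2l// lef_pV2 ?posrE ?exprn_gt0 ?P//.
have Px := ltW (P _ x0); have Py := ltW (P _ y0).
by rewrite ler_pXn2r ?nnegrE// lerD2r ler_wpM2l.
Qed.

(** The ratio is ((c + d) / d)^2 with c <= d. *)
Lemma word_weight_distortion s : pos s -> word_weight s 0 <= 4 * word_weight s 1.
Proof.
move=> /word_weight_mobius[A [c [d [A0 /andP[c0 cd] d0 E]]]].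
rewrite !E// mulr0 add0r mulr1 mulrCA ler_pM2l//.
have cd0 : 0 < c + d by rewrite ltr_wpDl.
rewrite ler_pdivlMr ?exprn_gt0// mulrC ler_pdivrMr ?exprn_gt0//.
nra.
Qed.

Let mnneg : measurable ([set x | 0 <= x] : set R).
Proof. by rewrite -set_itvcy; exact: measurable_itv. Qed.

Lemma measurable_word_map s (D : set R) : pos s -> measurable D ->
  (forall x, D x -> 0 <= x) -> measurable_fun D (word_map s).
Proof.
have H : pos s -> measurable_fun ([set x | 0 <= x] : set R) (word_map s).
  elim: s => [_|n s IH /= /andP[n0 /IH ms]]; first exact: measurable_id.
  apply: (measurable_comp _ _ ms) => //; last exact: measurable_branch.
  by move=> _ [x x0 <-] /=; exact/ltW/branch_gt0.
by move=> /H ms mD D0; apply: measurable_funS ms.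
Qed.

Lemma measurable_word_weight s (D : set R) : pos s -> measurable D ->
  (forall x, D x -> 0 <= x) -> measurable_fun D (word_weight s).
Proof.
have H : pos s -> measurable_fun ([set x | 0 <= x] : set R) (word_weight s).
  elim: s => [_|n s IH /= /andP[n0 /IH ms]]; first exact: measurable_cst.
  apply: measurable_funM; first exact: measurable_branch_weight.
  apply: (measurable_comp _ _ ms) => //; last exact: measurable_branch.
  by move=> _ [x x0 <-] /=; exact/ltW/branch_gt0.
by move=> /H ms mD D0; apply: measurable_funS ms.
Qed.

(** This is the integral of [F] over the image of (a,b) under the word, written
    on (a,b); with [F] constant equal to 1 it is the length of that image.
    Working on (a,b) makes all words comparable through their weights. *)
Definition word_mass (F : R -> R) s a b : R :=
  fine (\int[mu]_(x in `]a, b[) (word_weight s x * F (word_map s x))%:E)%E.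

Section word_mass.
Variables (F : R -> R) (K : R).
Hypotheses (mF : measurable_fun setT F) (F0 : forall x, 0 <= F x) (FK : forall x, F x <= K).

Let itv0 a b x : 0 <= a -> `]a, b[%classic x -> 0 <= x.
Proof. by move=> a0; rewrite /= in_itv/= => /andP[/ltW ax _]; exact: le_trans ax. Qed.

Lemma measurable_mass_integrand s a b : pos s -> 0 <= a ->
  measurable_fun (`]a, b[%classic : set R) (fun x => (word_weight s x * F (word_map s x))%:E).
Proof.
move=> s0 a0; apply/measurable_EFinP; apply: measurable_funM.
  by apply: measurable_word_weight => // x; exact: itv0.
apply: (measurable_comp _ _ mF) => //.
by apply: measurable_word_map => // x; exact: itv0.
Qed.

Let ge0_mass s a b x : pos s -> 0 <= a -> `]a, b[%classic x ->
  (0 <= (word_weight s x * F (word_map s x))%:E)%E.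
Proof. by move=> s0 a0 /itv0 x0; rewrite lee_fin mulr_ge0// ltW// word_weight_gt0// x0. Qed.

Lemma mass_fineK s a b : pos s -> 0 <= a ->
  (word_mass F s a b)%:E = (\int[mu]_(x in `]a, b[) (word_weight s x * F (word_map s x))%:E)%E.
Proof.
move=> s0 a0; rewrite fineK// ge0_fin_numE; last first.
  by apply: integral_ge0 => x; exact: ge0_mass.
have K0 : 0 <= K by exact: le_trans (FK 0).
apply: (@le_lt_trans _ _ (\int[mu]_(x in `]a, b[) (word_weight s 0 * K)%:E)%E).
  apply: ge0_le_integral => //.
  - by move=> x; exact: ge0_mass.
  - exact: measurable_mass_integrand.
  - move=> x /(itv0 a0) x0; rewrite lee_fin; apply: ler_pM => //.
      exact/ltW/word_weight_gt0.
    exact: word_weight_decr.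
rewrite integral_cst//= lebesgue_measure_itv/=; case: ifPn => _.
  by rewrite -EFinD -EFinM ltry.
by rewrite mule0 ltry.
Qed.

Lemma mass_ge0 s a b : pos s -> 0 <= a -> 0 <= word_mass F s a b.
Proof. by move=> s0 a0; rewrite fine_ge0// integral_ge0// => x; exact: ge0_mass. Qed.

(** Peeling off the last inverse step: an interval inside the branch domain of
    [n] is replaced by its image under x |-> q / x - n, with one more letter. *)
Lemma mass_cons n s a b : (0 < n)%N -> pos s -> 0 <= a -> a <= b ->
  word_mass F s (br n b) (br n a) = word_mass F (n :: s) a b.
Proof.
move=> n0 s0 a0 ab; rewrite /word_mass integral_branch//.
- by congr fine; apply: eq_integral => x _; rewrite -EFinM/= mulrA.
- by apply: measurable_mass_integrand => //; rewrite ltW// branch_gt0// (le_trans a0).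
- move=> z; apply: ge0_mass => //; rewrite ltW// branch_gt0// (le_trans a0)//.
Qed.

Lemma mass_split s a b c : pos s -> 0 <= a -> a <= b -> b <= c ->
  word_mass F s a c = word_mass F s a b + word_mass F s b c.
Proof.
move=> s0 a0 ab bc; apply: EFin_inj; have b0 := le_trans a0 ab.
rewrite EFinD !mass_fineK//.
move: bc; rewrite le_eqVlt => /predU1P[->|bc].
  by rewrite [X in (_ + X)%E](_ : _ = 0%E) ?adde0// set_itvoo0// integral_set0.
move: ab; rewrite le_eqVlt => /predU1P[->|ab].
  by rewrite [X in (X + _)%E](_ : _ = 0%E) ?add0e// set_itvoo0// integral_set0.
have E : `]a, c[%classic = `]a, b]%classic `|` `]b, c[%classic :> set R.
  by apply: itv_bndbnd_setU; rewrite bnd_simp// ltW.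
rewrite (@integral_itv_bndo_bndc _ (BRight a) b); last exact: measurable_mass_integrand.
rewrite E ge0_integral_setU//=.
- by rewrite -E; exact: measurable_mass_integrand.
- move=> x xE; have {xE} : (`]a, b]%classic `|` `]b, c[%classic : set R) x by [].
  by rewrite -E; exact: ge0_mass.
- apply/disj_setPS => x [/=]; rewrite !in_itv/= => /andP[_ xb] /andP[bx _].
  by move: (lt_le_trans bx xb); rewrite ltxx.
Qed.

Lemma mass_sub s a b a' b' : pos s -> 0 <= a -> a <= a' -> a' <= b' -> b' <= b ->
  word_mass F s a' b' <= word_mass F s a b.
Proof.
move=> s0 a0 aa' ab' bb'.
have a'0 := le_trans a0 aa'.
rewrite (@mass_split s a a' b)// ?(le_trans ab')//.
rewrite (@mass_split s a' b' b)//.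
rewrite addrCA lerDl addr_ge0// mass_ge0// (le_trans a'0)//.
Qed.

End word_mass.
End words.

(** * From full cylinders to intervals *)

Section growth.
Context {R : realType} (q : R).
Hypothesis q1 : 1 < q.
Local Notation mu := (@lebesgue_measure R).
Implicit Types (n : nat) (s : seq nat) (x y z a b c : R).

Let q0 : 0 < q. Proof. exact: lt_trans q1. Qed.

Local Notation br := (branch q).
Local Notation wt := (word_weight q).
Local Notation psi := (word_map q).
Local Notation valid := (word_valid q).
Local Notation mass := (word_mass q).
Local Notation pos := (all (fun n => 0 < n)%N).
Local Notation len := (mass (fun=> 1)).

Let mF1 : measurable_fun setT (fun _ : R => 1 : R). Proof. exact: measurable_cst. Qed.
Let F10 (x : R) : 0 <= (1 : R). Proof. exact: ler01. Qed.
Let F1K (x : R) : (1 : R) <= 1. Proof. exact: lexx. Qed.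

Let int_cst a b c : a <= b ->
  (\int[mu]_(x in (`]a, b[%classic : set R)) c%:E = (c * (b - a))%:E)%E.
Proof.
move=> ab; rewrite integral_cst//= lebesgue_measure_itv/= lte_fin.
move: ab; rewrite le_eqVlt => /predU1P[->|->]; last by rewrite -EFinD EFinM.
by rewrite ltxx mule0 subrr mulr0.
Qed.

Lemma len_le s a b : pos s -> 0 <= a -> a <= b -> len s a b <= wt s 0 * (b - a).
Proof.
move=> s0 a0 ab; rewrite -lee_fin (mass_fineK q0 mF1 F10 F1K)// -int_cst//.
apply: ge0_le_integral => //.
- move=> x /=; rewrite in_itv/= => /andP[/ltW ax _].
  by rewrite lee_fin mulr1 ltW// word_weight_gt0// (le_trans a0).
- exact: (measurable_mass_integrand q0 mF1).
- move=> x /=; rewrite in_itv/= => /andP[/ltW ax _].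
  by rewrite lee_fin mulr1 word_weight_decr// (le_trans a0).
Qed.

Lemma len_ge s a b : pos s -> 0 <= a -> a <= b -> b <= 1 ->
  wt s 1 * (b - a) <= len s a b.
Proof.
move=> s0 a0 ab b1; rewrite -lee_fin (mass_fineK q0 mF1 F10 F1K)// -int_cst//.
apply: ge0_le_integral => //.
- by move=> x _; rewrite lee_fin ltW// word_weight_gt0.
- exact: (measurable_mass_integrand q0 mF1).
- move=> x /=; rewrite in_itv/= => /andP[/ltW ax /ltW xb].
  by rewrite lee_fin mulr1 word_weight_decr ?(le_trans a0) ?(le_trans xb).
Qed.

(** Bounded distortion: proportions inside [0,1] are preserved by words up to
    the factor 4. *)
Lemma len_distortion s a b a' b' (k : R) : pos s -> 0 <= a -> a <= b ->
  0 <= a' -> a' < b' -> b' <= 1 -> b - a <= k * (b' - a') ->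
  len s a b <= 4 * k * len s a' b'.
Proof.
move=> s0 a0 ab a'0 ab' b'1 kab.
have h1 := len_le s0 a0 ab; have h2 := len_ge s0 a'0 (ltW ab') b'1.
have w := word_weight_distortion q0 s0; have w1 := word_weight_gt0 q0 s0 (@ler01 R).
have w0 := word_weight_gt0 q0 s0 (lexx 0).
have k0 : 0 <= k by nra.
apply: (le_trans h1); apply: (@le_trans _ _ (4 * wt s 1 * (k * (b' - a')))).
  by apply: ler_pM => //; [exact: ltW|lra].
rewrite (_ : _ * _ = 4 * k * (wt s 1 * (b' - a'))); last by ring.
by rewrite ler_wpM2l// mulr_ge0.
Qed.

Lemma valid_pos s x : valid s x -> pos s.
Proof. by elim: s x => //= n s IH x /and3P[-> _ /IH]. Qed.

(** A word valid on (0,1) maps it onto a full cylinder. *)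
Definition valid_on s a b := forall x, a < x -> x < b -> valid s x.

Lemma valid_on_sub s a b a' b' : valid_on s a b -> a <= a' -> b' <= b -> valid_on s a' b'.
Proof. by move=> v aa' bb' x xa xb; apply: v; [exact: le_lt_trans xa|exact: lt_le_trans bb']. Qed.

Lemma valid_on_cons n s a b : (0 < n)%N -> 0 < a -> a <= b -> b <= 1 -> n%:R <= q / b ->
  valid_on s a b -> valid_on (n :: s) (q / b - n%:R) (q / a - n%:R).
Proof.
move=> n0 a0 ab b1 nb v x bx xa.
have b0 : 0 < b by exact: lt_le_trans ab.
have x0 : 0 <= x by lra.
rewrite /= n0/=; move: bx xa; rewrite -branch_ltE// -branch_gtE// => bx xa.
by rewrite (lt_le_trans bx)//= v.
Qed.

Lemma branch_sub n y : 0 < y -> br n (q / y - n%:R) = y.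
Proof. by move=> y0; rewrite /branch addrC subrK; field; rewrite !gt_eqF. Qed.

Section lower_bound.
Variables (F : R -> R) (K delta : R).
Hypotheses (mF : measurable_fun setT F) (F0 : forall x, 0 <= F x) (FK : forall x, F x <= K).
Hypothesis d0 : 0 <= delta.

Lemma mass_cut (G : R -> R) n s a b : measurable_fun setT G -> (forall x, 0 <= G x) ->
  (0 < n)%N -> pos s -> 0 < a -> a <= b -> n%:R <= q / b ->
  mass G s a b = mass G (n :: s) (q / b - n%:R) (q / a - n%:R).
Proof.
move=> mG G0 n0 s0 a0 ab nb; have b0 : 0 < b by exact: lt_le_trans ab.
have ab' : q / b <= q / a by rewrite ler_pM2l// lef_pV2 ?posrE.
by rewrite -mass_cons// ?branch_sub//; lra.
Qed.

Hypothesis H : forall s, valid_on s 0 1 -> delta * len s 0 1 <= mass F s 0 1.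

Let sp s a b : pos s -> 0 <= a -> a <= b -> forall c, b <= c ->
  mass F s a c = mass F s a b + mass F s b c.
Proof. by move=> *; apply: (mass_split q0 mF F0 FK). Qed.

Let sp1 s a b : pos s -> 0 <= a -> a <= b -> forall c, b <= c ->
  len s a c = len s a b + len s b c.
Proof. by move=> *; apply: (mass_split q0 mF1 F10 F1K). Qed.

Lemma valid_on_pos s a b : a < b -> valid_on s a b -> pos s.
Proof. by move=> ab v; apply: (@valid_pos _ ((a + b) / 2)); apply: v; lra. Qed.

Let qk (k : nat) : (0 < k)%N -> q / (q / k%:R) = k%:R.
Proof. by move=> k0; field; rewrite !gt_eqF// ltr0n. Qed.

Let qk0 (k : nat) : (0 < k)%N -> 0 < q / k%:R.
Proof. by move=> k0; rewrite divr_gt0// ltr0n. Qed.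

Lemma full_branch s k : (0 < k)%N -> pos s -> q / k%:R <= 1 ->
  valid_on s (q / k.+1%:R) (q / k%:R) ->
  delta * len s (q / k.+1%:R) (q / k%:R) <= mass F s (q / k.+1%:R) (q / k%:R).
Proof.
move=> k0 s0 k1 v.
have kk : q / k.+1%:R <= q / k%:R.
  by rewrite ler_pM2l// lef_pV2 ?posrE ?ltr0n// ler_nat.
have Sk := qk0 (ltn0Sn k).
have nk : k%:R <= q / (q / k%:R) by rewrite qk.
have := valid_on_cons k0 Sk kk k1 nk v.
rewrite (mass_cut mF1 F10 k0 s0 Sk kk nk) (mass_cut mF F0 k0 s0 Sk kk nk).
rewrite !qk// subrr (_ : k.+1%:R - k%:R = 1); last by rewrite -natr1; ring.
exact: H.
Qed.

(** Consecutive full branch domains inside the domain of a word each give a full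
    cylinder, and the lower bounds add up. *)
Lemma full_branches s n k : (0 < n <= k)%N -> pos s -> q / n%:R <= 1 ->
  valid_on s (q / k%:R) (q / n%:R) ->
  delta * len s (q / k%:R) (q / n%:R) <= mass F s (q / k%:R) (q / n%:R).
Proof.
move=> /andP[n0 nk] s0 n1; elim: k nk => [|k IH] nk v.
  by move: n0; rewrite lt0n; case: n nk {n1 v}.
move: nk; rewrite leq_eqVlt => /predU1P[E|nk].
  rewrite E; set t := q / _.
  have z (G : R -> R) : mass G s t t = 0 by rewrite /mass set_itvoo0// integral_set0.
  by rewrite !z mulr0.
rewrite ltnS in nk; have k0 : (0 < k)%N by exact: leq_trans nk.
have kk : q / k.+1%:R <= q / k%:R.
  by rewrite ler_pM2l// lef_pV2 ?posrE ?ltr0n// ler_nat.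
have kn : q / k%:R <= q / n%:R.
  by rewrite ler_pM2l// lef_pV2 ?posrE ?ltr0n// ler_nat.
have Sk := ltW (qk0 (ltn0Sn k)).
rewrite (sp s0 Sk kk kn) (sp1 s0 Sk kk kn) mulrDr lerD//.
- apply: full_branch => //; first exact: le_trans n1.
  exact: valid_on_sub v _ _.
- by apply: IH => //; exact: valid_on_sub v _ _.
Qed.

(** When full branch domains fill the proportion 1/c of an interval, their lower
    bound passes to the interval: [F] is nonnegative on the rest, and bounded
    distortion compares the lengths. *)
Lemma covered_lower_bound s a b n k (c : R) : (0 < n < k)%N -> valid_on s a b ->
  0 <= a -> a <= q / k%:R -> q / n%:R <= b -> b <= 1 -> 0 <= c ->
  b - a <= c * (q / n%:R - q / k%:R) ->
  delta * len s a b <= 4 * c * mass F s a b.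
Proof.
move=> /andP[n0 nk] v a0 ak nb b1 c0 ab.
have k0 : (0 < k)%N by exact: ltn_trans nk.
have kn : q / k%:R < q / n%:R.
  by rewrite ltr_pM2l// ltf_pV2 ?posrE ?ltr0n// ltr_nat.
have s0 : pos s by apply: valid_on_pos v; lra.
have sub : mass F s (q / k%:R) (q / n%:R) <= mass F s a b.
  by apply: (mass_sub q0 mF F0 FK) => //; exact: ltW.
have full : delta * len s (q / k%:R) (q / n%:R) <= mass F s (q / k%:R) (q / n%:R).
  apply: full_branches => //; first by rewrite n0 ltnW.
    exact: le_trans b1.
  exact: valid_on_sub v _ _.
have ab' : a <= b by lra.
have := len_distortion s0 a0 ab' (ltW (qk0 k0)) kn (le_trans nb b1) ab.
move=> /(ler_wpM2l d0) h; apply: (le_trans h).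
by rewrite mulrCA ler_wpM2l ?mulr_ge0//; exact: le_trans sub.
Qed.

(** For x = q / z, the number [n] is the index of the branch domain of z. *)
Lemma nat_ceil x : 1 < x -> exists2 n, (0 < n)%N & n%:R < x <= n.+1%:R.
Proof.
move=> x1; have ex : exists n, x <= n%:R.
  by exists (Num.bound x); apply/ltW/archi_boundP; exact/ltW/(lt_trans ltr01).
case: (ex_minnP ex) => -[|[|n]] xn mn.
- by move: xn; rewrite leNgt (lt_trans _ x1).
- by move: xn; rewrite leNgt x1.
exists n.+1 => //; rewrite xn andbT ltNge; apply/negP => /mn.
by rewrite ltnn.
Qed.

(** If e lies in the branch domain of index n, the full branch domains of index
    n+1, ..., 2n+1 are contained in (0,e) and fill at least a quarter of it. *)
Lemma left0_lower_bound s e : 0 < e -> e <= 1 -> valid_on s 0 e ->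
  delta * len s 0 e <= 16 * mass F s 0 e.
Proof.
move=> e0 e1 v.
have qe : 1 < q / e by rewrite ltr_pdivlMr// mul1r (le_lt_trans e1).
have [n n0 /andP[nq qn]] := nat_ceil qe.
have n1 : 1 <= n%:R :> R by rewrite ler1n.
have n0' : 0 < n%:R :> R by lra.
rewrite (_ : 16 = 4 * 4); last by rewrite -natrM.
have N0 : 0 < n.+1%:R :> R by rewrite ltr0n.
apply: (@covered_lower_bound _ _ _ n.+1 n.+1.*2) => //.
- by rewrite /= -addnn -[X in (X < _)%N]addn0 ltn_add2l.
- by rewrite divr_ge0// ltW.
- by rewrite ler_pdivrMr// mulrC -ler_pdivrMr.
- rewrite subr0 -mul2n natrM invfM mulrA.
  have -> : 4 * (q / n.+1%:R - q / 2 / n.+1%:R) = 2 * q / n.+1%:R.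
    by field; rewrite gt_eqF.
  rewrite ler_pdivlMr// mulrC.
  have : n%:R * e < q by rewrite -ltr_pdivlMr.
  rewrite -natr1; nra.
Qed.

(** For an interval ending at the discontinuity q / n there are three cases.
    Inside one branch domain, T maps it onto an interval (0,e).  If it contains
    the domains of index n, ..., 2n-1, these fill at least half of it.  Otherwise
    what the full branch domains leave uncovered lies in a single branch domain,
    of index less than 2n, which is not longer than the domain of index n. *)
Lemma left_lower_bound s a n : (1 < n)%N -> 0 <= a -> a < q / n%:R -> q / n%:R <= 1 ->
  valid_on s a (q / n%:R) ->
  delta * len s a (q / n%:R) <= 16 * mass F s a (q / n%:R).
Proof.
move=> n1 a0 an qn1 v; have n0 : (0 < n)%N by exact: ltnW.
have n0' : 0 < n%:R :> R by rewrite ltr0n.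
have n1' : 1 < n%:R :> R by rewrite ltr1n.
have s0 := valid_on_pos an v.
have [ge|lt] := leP (q / n.+1%:R) a.
  have a0' : 0 < a by apply: lt_le_trans ge; exact: qk0.
  have nk : n%:R <= q / (q / n%:R) by rewrite qk.
  rewrite (mass_cut mF1 F10 n0 s0 a0' (ltW an) nk) (mass_cut mF F0 n0 s0 a0' (ltW an) nk).
  have := valid_on_cons n0 a0' (ltW an) qn1 nk v.
  rewrite !qk// subrr => v'.
  apply: left0_lower_bound => //.
  - by rewrite subr_gt0 ltr_pdivlMr// mulrC -ltr_pdivlMr.
  - by rewrite lerBlDr addrC natr1 ler_pdivrMr// mulrC -ler_pdivrMr// ltr0n.
rewrite (_ : 16 = 4 * 4); last by rewrite -natrM.
have [le2|gt2] := leP a (q / n.*2%:R).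
  apply: (@covered_lower_bound _ _ _ n n.*2) => //.
  - by rewrite n0 -addnn -[X in (X < _)%N]addn0 ltn_add2l.
  - rewrite -mul2n natrM invfM mulrA.
    have -> : 4 * (q / n%:R - q / 2 / n%:R) = 2 * q / n%:R by field; rewrite gt_eqF.
    have : 0 < q / n%:R by exact: qk0.
    rewrite -mulrA; lra.
have a0' : 0 < a by apply: lt_trans gt2; apply: qk0; rewrite double_gt0.
have qa0 : 0 <= q / a by rewrite divr_ge0// ltW.
pose k := Num.truncn (q / a).
have /andP[ka ak] := truncn_itv qa0.
rewrite -/k in ka ak.
have kn : (n < k)%N.
  rewrite -ltnS -(@ltr_nat R); apply: lt_trans ak.
  by rewrite ltr_pdivlMr// mulrC -ltr_pdivlMr// ltr0n.
have k0 : (0 < k)%N by exact: ltn_trans kn.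
apply: (@covered_lower_bound _ _ _ n k) => //.
- by rewrite n0.
- by rewrite ler_pdivlMr ?ltr0n// mulrC -ler_pdivlMr.
have k0' : 0 < k%:R :> R by rewrite ltr0n.
have kn' : n%:R + 1 <= k%:R :> R by rewrite natr1 ler_nat.
(* With u = q / k, v = q / (k + 1) and w = q / n, the uncovered part (a,u) is
   contained in the branch domain (v,u), which is shorter than (u,w). *)
have av : q / k.+1%:R < a by rewrite ltr_pdivrMr ?ltr0n// mulrC -ltr_pdivrMr.
have Eu : q / k%:R * k%:R = q by rewrite divfK// gt_eqF.
have Ev : q / k.+1%:R * (k%:R + 1) = q by rewrite natr1 divfK// gt_eqF// ltr0n.
have Ew : q / n%:R * n%:R = q by rewrite divfK// gt_eqF.
have u0 := qk0 k0; have v0 := qk0 (ltn0Sn k); have w0 := qk0 n0.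
move: (q / k%:R) (q / k.+1%:R) (q / n%:R) Eu Ev Ew u0 v0 w0 av {v lt gt2 an qn1} => u v w.
move=> Eu Ev Ew u0 v0 w0 va.
have uv : (u - v) * k%:R = v by rewrite mulrBl Eu -{1}Ev; ring.
have vu : v <= u by nra.
have wu : u <= (w - u) * n%:R by rewrite mulrBl Ew -{1}Eu; nra.
have : (u - v) * n%:R <= (w - u) * n%:R by nra.
rewrite ler_pM2r//; nra.
Qed.

(** Let n be the index of the branch domain of b, and p = q / (n + 1) the largest
    discontinuity that is at most b.  If p <= a, the interval is stretched by T.
    If p - a is at least (q - 1) / 2 times b - p, then (a,p) is at least
    the fraction (q - 1) / (q + 1) of (a,b) and its lower bound suffices, up to distortion;
    this produces the final constants.  Otherwise b - a is less than
    (q + 1) / 2 times b - p, so the image of (p,b), which is at least q times as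
    long as (p,b), is longer than (a,b) by the factor 2 q / (q + 1).  The
    exponent [N] counts the stretchings possible before the length exceeds 1. *)
Lemma interval_lower_bound_iter N s a b : 0 <= a -> a < b -> b <= 1 -> valid_on s a b ->
  1 < (b - a) * (2 * q / (q + 1)) ^+ N ->
  (q - 1) * delta * len s a b <= 64 * (q + 1) * mass F s a b.
Proof.
have hq1 := q1; elim: N s a b => [|N IH] s a b a0 ab b1 v; first by rewrite expr0 mulr1; lra.
have b0 : 0 < b by exact: le_lt_trans ab.
have s0 := valid_on_pos ab v.
set r := 2 * q / (q + 1) in IH *.
have q1p1 : 0 < q + 1 by exact: addr_gt0.
have rE : r * (q + 1) = 2 * q by rewrite /r divfK// gt_eqF.
have r0 : 0 < r by rewrite /r divr_gt0// mulr_gt0.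
have rq : r <= q.
  by rewrite /r ler_pdivrMr// mulrC ler_pM2l// -[2]/(1 + 1) lerD2r ltW.
clearbody r.
rewrite exprS mulrA => long.
have qb : 1 < q / b by rewrite ltr_pdivlMr// mul1r (le_lt_trans b1).
have [n n0 /andP[nb bn]] := nat_ceil qb.
have pb : q / n.+1%:R <= b by rewrite ler_pdivrMr ?ltr0n// mulrC -ler_pdivrMr.
have p0 : 0 < q / n.+1%:R by exact: qk0.
(* The part (c,b) lies in one branch domain and is followed further, provided
   that T makes it longer than (a,b) by the factor r. *)
have right c : q / n.+1%:R <= c -> a <= c -> c < b -> r * (b - a) <= q * (b - c) ->
    (q - 1) * delta * len s c b <= 64 * (q + 1) * mass F s c b.
  move=> pc ac cb rqc; have c0 : 0 < c by exact: lt_le_trans pc.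
  have cb' : 0 < b * c by rewrite mulr_gt0.
  rewrite (mass_cut mF1 F10 n0 s0 c0 (ltW cb) (ltW nb)).
  rewrite (mass_cut mF F0 n0 s0 c0 (ltW cb) (ltW nb)).
  have rba : 0 < r * (b - a) by rewrite mulr_gt0// subr_gt0.
  have grow : r * (b - a) <= q / c - n%:R - (q / b - n%:R).
    have -> : q / c - n%:R - (q / b - n%:R) = q * (b - c) / (b * c).
      by field; rewrite !gt_eqF.
    rewrite ler_pdivlMr//; apply: le_trans rqc; rewrite ler_piMr ?(ltW rba)//.
    by rewrite mulr_ile1 ?(ltW b0) ?(ltW c0)// (le_trans (ltW cb)).
  apply: IH.
  - by rewrite subr_ge0 ltW.
  - by rewrite -subr_gt0; exact: lt_le_trans grow.
  - by rewrite lerBlDr addrC natr1 ler_pdivrMr// mulrC -ler_pdivrMr// ltr0n.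
  - by apply: valid_on_cons => //; [exact: ltW|exact: ltW|exact: valid_on_sub v _ _].
  - apply: (lt_le_trans long); rewrite [r * _]mulrC in grow.
    by rewrite ler_pM2r// exprn_gt0.
have [pa|ap] := leP (q / n.+1%:R) a.
  by apply: right => //; rewrite ler_pM2r ?subr_gt0.
have left := @left_lower_bound s a n.+1 n0 a0 ap (le_trans pb b1)
  (valid_on_sub v (lexx a) pb).
move: (q / n.+1%:R) p0 pb right ap left => p p0 pb right ap left.
have mL := mass_ge0 q0 F0 p s0 a0.
have [short|long'] := ltP (p - a) ((q - 1) / 2 * (b - p)).
  have pb' : p < b by nra.
  rewrite (sp s0 a0 (ltW ap) pb) (sp1 s0 a0 (ltW ap) pb) [leLHS]mulrDr [leRHS]mulrDr lerD//.
    have : (q - 1) * (delta * len s a p) <= (q - 1) * (16 * mass F s a p).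
      by rewrite ler_wpM2l// subr_ge0 ltW.
    by rewrite mulrA => /le_trans; apply; rewrite mulrA ler_wpM2r//; lra.
  apply: right => //; first exact: ltW.
  have : r * (b - a) <= r * ((q + 1) / 2 * (b - p)) by rewrite ler_wpM2l ?(ltW r0)//; lra.
  move=> /le_trans; apply.
  by rewrite (_ : r * _ = r * (q + 1) * (b - p) / 2); [rewrite rE; lra|field].
have mLab : mass F s a p <= mass F s a b by apply: (mass_sub q0 mF F0 FK) => //; exact: ltW.
have q1' : 0 < q - 1 by lra.
have := @len_distortion s a b a p ((q + 1) / (q - 1)) s0 a0 (ltW ab) a0 ap (le_trans pb b1).
have -> : b - a <= (q + 1) / (q - 1) * (p - a).
  by rewrite mulrAC ler_pdivlMr//; nra.
move=> /(_ isT) h.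
have h' : (q - 1) * len s a b <= 4 * (q + 1) * len s a p.
  apply: le_trans (ler_wpM2l (ltW q1') h) _.
  by rewrite le_eqVlt; apply/orP; left; apply/eqP; field; rewrite gt_eqF.
have q1p : 0 <= 4 * (q + 1) by lra.
have := ler_wpM2l d0 h'; have := ler_wpM2l q1p left; nra.
Qed.

Lemma interval_lower_bound a b : 0 <= a -> a < b -> b <= 1 ->
  (q - 1) * delta * (b - a) <= 64 * (q + 1) * mass F [::] a b.
Proof.
move=> a0 ab b1.
have -> : b - a = len [::] a b.
  apply: EFin_inj; rewrite (mass_fineK q0 mF1 F10 F1K)//=.
  by rewrite mulr1 int_cst ?mul1r// ltW.
have ba : 0 < b - a by rewrite subr_gt0.
have [N hN] : exists N, 1 < (b - a) * (2 * q / (q + 1)) ^+ N.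
  set r := _ / _.
  have r1 : 0 < r - 1.
    by rewrite subr_gt0 /r ltr_pdivlMr ?addr_gt0// mul1r mulr2n mulrDl mul1r ltrD2l.
  (* Bernoulli's inequality makes the powers of r unbounded. *)
  have bern N : N%:R * (r - 1) < r ^+ N.
    elim: N => [|N IH]; first by rewrite mul0r expr0.
    have rN : 1 <= r ^+ N by rewrite exprn_ege1//; lra.
    by rewrite exprS -natr1; nra.
  pose x := 1 / ((b - a) * (r - 1)).
  have x0 : 0 <= x by rewrite divr_ge0// mulr_ge0// ltW.
  exists (Num.bound x); have xb := archi_boundP x0.
  have := bern (Num.bound x); rewrite -(ltr_pM2l ba _ (r ^+ _)); apply: lt_trans.
  by move: xb; rewrite /x ltr_pdivrMr ?mulr_gt0// mulrCA.
by apply: interval_lower_bound_iter hN.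
Qed.

End lower_bound.

End growth.

(** * Moduli and phases of complex numbers *)

Section cabs.
Context {R : realType}.
Implicit Types z w : R[i].

Local Notation Re := (@complex.Re R).
Local Notation Im := (@complex.Im R).

(** The norm of a complex number is again a complex number; [cabs] is the real-valued modulus.  The
    phase [csign] of 0 is 0, so a vanishing phase detects a zero. *)
Definition cabs z : R := Re `|z|.
Definition csign z : R[i] := z / `|z|.

Lemma cabsE z : (cabs z)%:C = `|z|.
Proof. by rewrite /cabs RRe_real// normr_real. Qed.

Lemma cabs_sqrt z : cabs z = Num.sqrt (Re z ^+ 2 + Im z ^+ 2).
Proof. by rewrite /cabs normc_def. Qed.

Lemma cabs_ge0 z : 0 <= cabs z. Proof. by rewrite cabs_sqrt sqrtr_ge0. Qed.

Lemma cabs0 : cabs 0 = 0. Proof. by rewrite /cabs normr0. Qed.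

Lemma cabs_eq0 z : (cabs z == 0) = (z == 0).
Proof. by rewrite -(inj_eq (@complexI R)) cabsE normr_eq0. Qed.

Lemma cabsM z w : cabs (z * w) = cabs z * cabs w.
Proof. by apply: (@complexI R); rewrite rmorphM/= !cabsE normrM. Qed.

Lemma ler_cabsD z w : cabs (z + w) <= cabs z + cabs w.
Proof. by rewrite -lecR rmorphD/= !cabsE ler_normD. Qed.

Lemma cabs_real (r : R) : cabs r%:C = `|r|.
Proof. by rewrite cabs_sqrt/= expr0n/= addr0 sqrtr_sqr. Qed.

Lemma cabs_unit z w : `|z| = 1 -> cabs (z * w) = cabs w.
Proof. by move=> z1; rewrite cabsM /cabs z1 mul1r. Qed.

Lemma normRe_cabs z : `|Re z| <= cabs z.
Proof. by rewrite cabs_sqrt -sqrtr_sqr ler_wsqrtr// lerDl sqr_ge0. Qed.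

Lemma normIm_cabs z : `|Im z| <= cabs z.
Proof. by rewrite cabs_sqrt -sqrtr_sqr ler_wsqrtr// lerDr sqr_ge0. Qed.

Lemma cabs_le_ReIm z : cabs z <= `|Re z| + `|Im z|.
Proof.
have h : 0 <= `|Re z| + `|Im z| by rewrite addr_ge0.
rewrite cabs_sqrt -[leRHS]ger0_norm// -sqrtr_sqr ler_wsqrtr//.
rewrite sqrrD !real_normK ?num_real// lerD2r lerDl mulrn_wge0// mulr_ge0//.
Qed.

Lemma Re_sub z w : Re (z - w) = Re z - Re w. Proof. by case: z w => [a b] [c d]. Qed.
Lemma Im_sub z w : Im (z - w) = Im z - Im w. Proof. by case: z w => [a b] [c d]. Qed.

Lemma Re_sum (I : Type) (r : seq I) (P : pred I) (a : I -> R[i]) :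
  Re (\sum_(i <- r | P i) a i) = \sum_(i <- r | P i) Re (a i).
Proof. by apply: (big_morph Re) => // -[? ?] [? ?]. Qed.
Lemma Im_sum (I : Type) (r : seq I) (P : pred I) (a : I -> R[i]) :
  Im (\sum_(i <- r | P i) a i) = \sum_(i <- r | P i) Im (a i).
Proof. by apply: (big_morph Im) => // -[? ?] [? ?]. Qed.

Lemma csign0 : csign 0 = 0. Proof. by rewrite /csign mul0r. Qed.

Lemma csign_eq0 z : (csign z == 0) = (z == 0).
Proof. by rewrite /csign mulf_eq0 invr_eq0 normr_eq0 orbb. Qed.

Lemma csignE z : (cabs z)%:C * csign z = z.
Proof.
rewrite /csign cabsE; have [->|z0] := eqVneq z 0; first by rewrite mul0r mulr0.
by rewrite mulrC divfK// normr_eq0.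
Qed.

Lemma csign_unit w z : `|w| = 1 -> csign (w * z) = w * csign z.
Proof. by move=> w1; rewrite /csign normrM w1 mul1r mulrA. Qed.

Lemma normr_csign z : z != 0 -> `|csign z| = 1.
Proof. by move=> z0; rewrite /csign normrM normfV normr_id divff// normr_eq0. Qed.

Lemma cabs_conj_csign z : Re (conjc (csign z) * z) = cabs z.
Proof.
have [->|z0] := eqVneq z 0; first by rewrite mulr0 cabs0.
rewrite -[X in _ * X]csignE mulrCA [conjc _ * _]mulrC -sqr_normc normr_csign//.
by rewrite expr1n mulr1.
Qed.

(** The rotated number y = conj(csign w) z satisfies |y|^2 = (Re y)^2 + (Im y)^2
    and Re y = |y|, which leaves Im y = 0. *)
Lemma eq_csign z w : w != 0 -> Re (conjc (csign w) * z) = cabs z -> z = (cabs z)%:C * csign w.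
Proof.
move=> w0 h; set y := conjc (csign w) * z in h.
have u1 : csign w * conjc (csign w) = 1 by rewrite -sqr_normc normr_csign// expr1n.
have yz : cabs y = cabs z by rewrite /y cabs_unit// normcJ normr_csign.
suff yE : y = (cabs z)%:C by rewrite -yE /y mulrAC [_ * csign w]mulrC u1 mul1r.
have Im0 : Im y = 0.
  apply/eqP; rewrite -sqrf_eq0; apply/eqP.
  have : cabs y ^+ 2 = Re y ^+ 2 + Im y ^+ 2.
    by rewrite cabs_sqrt sqr_sqrtr// addr_ge0// sqr_ge0.
  by rewrite yz h => /eqP; rewrite -subr_eq0 opprD addNKr oppr_eq0 => /eqP.
by move: Im0 h; case: (y) => a b /= -> ->.
Qed.

End cabs.

(** * Complex series without cancellation *)

Section series.
Context {R : realType}.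
Local Notation Re := (@complex.Re R).
Local Notation Im := (@complex.Im R).
Variables (a : nat -> R[i]) (c : nat -> R) (C : R).
Hypothesis ac : forall n, cabs (a n) <= c n.
Hypothesis cC : (\sum_(k < n) c k) @[n --> \oo] --> C.

Let abs_cvg (b : nat -> R) : (forall n, `|b n| <= c n) ->
  exists l : R, (\sum_(k < n) b k) @[n --> \oo] --> l.
Proof.
move=> bc; have : cvgn (series b).
  apply: normed_cvg.
  apply: (@series_le_cvg _ (fun n => `|b n|) c) => //.
    by move=> n; apply: le_trans (bc n).
  by apply/cvg_ex; exists C; rewrite seriesEord.
by move/cvg_ex => [l]; rewrite seriesEord => hl; exists l.
Qed.

(** Dominated series converge because their real and imaginary parts do. *)
Lemma complex_series_cvg : exists s : R[i],
  (fun n => \sum_(k < n) a k : R[i]^o) @ \oo --> (s : R[i]^o).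
Proof.
have [l1 h1] : exists l : R, (\sum_(k < n) Re (a k)) @[n --> \oo] --> l.
  apply: (abs_cvg (b := fun k => Re (a k))) => n.
  by apply: le_trans (ac n); exact: normRe_cabs.
have [l2 h2] : exists l : R, (\sum_(k < n) Im (a k)) @[n --> \oo] --> l.
  apply: (abs_cvg (b := fun k => Im (a k))) => n.
  by apply: le_trans (ac n); exact: normIm_cabs.
exists (l1 +i* l2); apply/cvgrPdist_lt => e e0.
have e'0 : 0 < Re e by move: e0; rewrite ltcE => /andP[].
have ee' : e = (Re e)%:C by rewrite RRe_real// gtr0_real.
have e20 : 0 < Re e / 2 by rewrite divr_gt0.
near=> n.
rewrite ee' -cabsE ltcR; apply: le_lt_trans (cabs_le_ReIm _) _.
rewrite Re_sub Im_sub Re_sum Im_sum [Re e]splitr ltrD//=.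
- by near: n; move/cvgrPdist_lt : h1; apply.
- by near: n; move/cvgrPdist_lt : h2; apply.
Unshelve. all: by end_near. Qed.

Variable s : R[i].
Hypothesis as_ : (fun n => \sum_(k < n) a k : R[i]^o) @ \oo --> (s : R[i]^o).

Let Re_cvg (u : R[i]) : (\sum_(k < n) Re (u * a k)) @[n --> \oo] --> Re (u * s).
Proof.
have [->|u0] := eqVneq u 0.
  rewrite mul0r; under eq_fun do under eq_bigr do rewrite mul0r.
  by under eq_fun do rewrite big1//; exact: cvg_cst.
apply/cvgrPdist_lt => e e0.
have uu0 : 0 < cabs u by rewrite lt_neqAle cabs_ge0 andbT eq_sym cabs_eq0.
have eu0 : 0 < e / cabs u by rewrite divr_gt0.
near=> n.
rewrite -Re_sum -Re_sub -mulr_sumr -mulrBr.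
apply: le_lt_trans (normRe_cabs _) _; rewrite cabsM mulrC -ltr_pdivlMr//.
rewrite -ltcR cabsE; near: n.
have eu0' : 0 < (e / cabs u)%:C by rewrite ltcR.
by move/cvgrPdist_lt : as_; apply.
Unshelve. all: by end_near. Qed.

Let Re_unit_le (u z : R[i]) : cabs u <= 1 -> Re (u * z) <= cabs z.
Proof.
move=> u1; apply: le_trans (ler_norm _) _; apply: le_trans (normRe_cabs _) _.
by rewrite cabsM ler_piMl// cabs_ge0.
Qed.

Let csign1 (z : R[i]) : cabs (conjc (csign z)) <= 1.
Proof.
rewrite -lecR cabsE normcJ; have [->|z0] := eqVneq z 0; first by rewrite csign0 normr0 ler01.
by rewrite normr_csign.
Qed.

Lemma complex_series_le : cabs s <= C.
Proof.
rewrite -cabs_conj_csign; apply: (ler_cvg_to (@Re_cvg (conjc (csign s))) cC); near=> n.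
by apply: ler_sum => k _; apply: le_trans (Re_unit_le _ (csign1 _)) (ac k).
Unshelve. all: by end_near. Qed.

(** Rotate the sum to the positive axis.  The bounds minus the real parts of the
    rotated terms are nonnegative and sum to [C - cabs s], so all of them vanish:
    each rotated term is real and equal to its bound. *)
Lemma complex_series_phase n : C <= cabs s -> a n = (c n)%:C * csign s.
Proof.
move=> Cs; set u := conjc (csign s).
have gap k : 0 <= c k - Re (u * a k).
  by rewrite subr_ge0; apply: le_trans (Re_unit_le _ (csign1 _)) (ac k).
have gap0 : c n - Re (u * a n) <= 0.
  have h : (\sum_(k < m) (c k - Re (u * a k))) @[m --> \oo] --> C - Re (u * s).
    under eq_fun do rewrite sumrB.
    by apply: cvgB => //; exact: Re_cvg.
  apply: (@le_trans _ _ (C - Re (u * s))); last by rewrite /u cabs_conj_csign subr_le0.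
  apply: (ler_cvg_to (cvg_cst _) h); near=> m.
  have nm : (n < m)%N by near: m; exact: nbhs_infty_gt.
  by rewrite (bigD1 (Ordinal nm))//= lerDl sumr_ge0.
have cu : c n = Re (u * a n) by apply/eqP; rewrite -subr_eq0 eq_le gap0 gap.
have ca : c n = cabs (a n).
  by apply/eqP; rewrite eq_le ac andbT cu; apply: Re_unit_le; exact: csign1.
have [s0|s0] := eqVneq s 0.
  have cn0 : c n = 0 by rewrite cu /u s0 csign0 conjc0 mul0r.
  by rewrite s0 csign0 mulr0; apply/eqP; rewrite -cabs_eq0 -ca cn0.
by rewrite ca; apply: eq_csign => //; rewrite -/u -cu.
Unshelve. all: by end_near. Qed.

End series.

Section nneseries_real.
Context {R : realType}.

Lemma cvg_nneseries_fine (c : nat -> R) (S : \bar R) :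
  (forall n, 0 <= c n) -> (\sum_(0 <= n <oo) (c n)%:E)%E = S -> (S < +oo)%E ->
  (\sum_(k < n) c k) @[n --> \oo] --> fine S.
Proof.
move=> c0 cS Soo.
have S0 : (0 <= S)%E by rewrite -cS; apply: nneseries_ge0 => n _ _; rewrite lee_fin.
have Sfin : S \is a fin_num by rewrite ge0_fin_numE.
have : (\sum_(0 <= k < n) (c k)%:E)%E @[n --> \oo] --> S.
  rewrite -cS; apply: is_cvg_ereal_nneg_natsum_cond => n _ _.
  by rewrite lee_fin.
rewrite -(fineK Sfin); under eq_fun do rewrite sumEFin big_mkord.
by move/fine_cvgP => [].
Qed.

Lemma nneseries_term_le (c : nat -> \bar R) n :
  (forall n, (0 <= c n)%E) -> (c n <= \sum_(0 <= k <oo) c k)%E.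
Proof.
move=> c0; apply: le_trans (nneseries_lim_ge n.+1 _) => //.
by rewrite big_nat_recr//= leeDr// sume_ge0.
Qed.

End nneseries_real.

(** * The Perron-Frobenius operator on nonnegative functions *)

Section transfer_operator.
Context {R : realType} (q : R).
Hypothesis q1 : 1 < q.
Let q0 : 0 < q. Proof. exact: lt_trans q1. Qed.
Local Notation mu := (@lebesgue_measure R).
Local Notation br := (branch q).
Local Notation jac := (branch_weight q).

Lemma I01E (x : R) : I01 x <-> 0 < x < 1.
Proof. by rewrite /I01/= in_itv. Qed.

(** Extended-real values make the operator total on nonnegative functions;
    vanishing off (0,1) allows it to be iterated. *)
Definition perron_frobenius (F : R -> \bar R) : R -> \bar R :=
  (fun x => \sum_(0 <= n <oo) ((jac n.+1 x)%:E * F (br n.+1 x)))%E \_ I01.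

Local Notation pf := perron_frobenius.

Lemma pfE F x : I01 x -> pf F x = (\sum_(0 <= n <oo) ((jac n.+1 x)%:E * F (br n.+1 x)))%E.
Proof. by move=> Ix; rewrite /perron_frobenius patchE mem_set. Qed.

Section pf.
Variable F : R -> \bar R.
Hypotheses (mF : measurable_fun setT F) (F0 : forall x, (0 <= F x)%E).
Hypothesis F01 : forall x, ~ I01 x -> F x = 0%E.

Let Ige0 (x : R) : I01 x -> 0 <= x. Proof. by move/I01E => /andP[/ltW]. Qed.

Let mI : measurable (I01 : set R). Proof. exact: measurable_itv. Qed.

Let term_ge0 n (x : R) : I01 x -> (0 <= (jac n.+1 x)%:E * F (br n.+1 x))%E.
Proof. by move=> /Ige0 x0; rewrite mule_ge0// lee_fin ltW// branch_weight_gt0. Qed.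

Let mterm n : measurable_fun (I01 : set R) (fun x => (jac n.+1 x)%:E * F (br n.+1 x))%E.
Proof.
apply: emeasurable_funM.
  by apply/measurable_EFinP; apply: measurable_branch_weight.
by apply: (measurable_comp _ _ mF) => //; apply: measurable_branch.
Qed.

Lemma pf_ge0 x : (0 <= pf F x)%E.
Proof.
rewrite /perron_frobenius patchE; case: ifPn => // /set_mem Ix.
by apply: nneseries_ge0 => n _ _; exact: term_ge0.
Qed.

Lemma measurable_pf : measurable_fun setT (pf F).
Proof.
apply/(measurable_restrictT _ mI).
apply: ge0_emeasurable_sum => //.
by move=> n x Ix _; exact: term_ge0.
Qed.

Lemma pf_out x : ~ I01 x -> pf F x = 0%E.
Proof. by move=> nI; rewrite /perron_frobenius patchE memNset. Qed.

(** The branches map (0,1) onto the disjoint branch domains (q / (n + 1), q / n),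
    which cover (0,1) up to end points; what they cover beyond (0,1) does not
    count since [F] vanishes there. *)
Lemma integral_pf : (\int[mu]_(x in I01) pf F x = \int[mu]_(x in I01) F x)%E.
Proof.
transitivity (\int[mu]_(x in I01) \sum_(0 <= n <oo) ((jac n.+1 x)%:E * F (br n.+1 x)))%E.
  by apply: eq_integral => x /set_mem Ix; rewrite pfE.
rewrite integral_nneseries//.
pose B n : set R := `[(q / n.+2%:R), (q / n.+1%:R)[%classic.
transitivity (\sum_(0 <= n <oo) \int[mu]_(z in B n) F z)%E.
  apply: eq_eseriesr => n _.
  rewrite /I01 -integral_branch//; last exact: measurable_funTS.
  rewrite /branch addr0 natr1 /B -(@integral_itv_obnd_cbnd _ _ (BLeft _))//.
  exact: measurable_funTS.
rewrite -ge0_integral_bigcup//.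
- rewrite [LHS]integral_mkcond [RHS]integral_mkcond; apply: eq_integral => x _.
  rewrite !patchE.
  have [Ix|nI] := pselect (I01 x); last first.
    by rewrite F01//; case: ifP; case: ifP.
  rewrite (mem_set Ix) mem_set//.
  have /I01E/andP[x0 x1] := Ix.
  have qx : 1 < q / x by rewrite ltr_pdivlMr// mul1r (lt_trans x1).
  have [n n0 /andP[nq qn]] := nat_ceil qx.
  case: n n0 nq qn => // n _ nq qn; exists n => //.
  rewrite /B/= in_itv/=; apply/andP; split.
    by rewrite ler_pdivrMr ?ltr0n// mulrC -ler_pdivrMr.
  by rewrite ltr_pdivlMr ?ltr0n// mulrC -ltr_pdivlMr.
- by move=> n; exact: measurable_itv.
- exact: measurable_funTS.
- apply: ltn_trivIset => n m mn; rewrite -subset0 => z [].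
  rewrite /B/= !in_itv/= => /andP[mz _] /andP[_ zn].
  have := le_lt_trans mz zn; rewrite ltNge => /negP; apply.
  by rewrite ler_pM2l// lef_pV2 ?posrE ?ltr0n// ler_nat.
Qed.

End pf.

End transfer_operator.

(** * Twisted transfer operators *)

Section ae_tools.
Context d (T : measurableType d) {R : realType} (mu : {measure set T -> \bar R}).

Lemma ae_imply (P P' : T -> Prop) : (forall x, P x -> P' x) ->
  {ae mu, forall x, P x} -> {ae mu, forall x, P' x}.
Proof. by move=> PP'; apply: filterS. Qed.

Lemma ae_imply2 (P1 P2 P' : T -> Prop) : (forall x, P1 x -> P2 x -> P' x) ->
  {ae mu, forall x, P1 x} -> {ae mu, forall x, P2 x} -> {ae mu, forall x, P' x}.
Proof. by move=> PP'; apply: filterS2. Qed.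

(** The nonnegative difference of the two functions has integral zero. *)
Lemma ae_eq_of_le_integral (D : set T) (F G : T -> \bar R) :
  measurable D -> measurable_fun D F -> measurable_fun D G ->
  (forall x, D x -> (0 <= F x)%E) -> (forall x, D x -> (0 <= G x)%E) ->
  {ae mu, forall x, D x -> (F x <= G x)%E} ->
  (\int[mu]_(x in D) G x < +oo)%E ->
  (\int[mu]_(x in D) G x <= \int[mu]_(x in D) F x)%E ->
  {ae mu, forall x, D x -> F x = G x}.
Proof.
move=> mD mF mG F0 G0 FG Goo GF.
have iG : mu.-integrable D G.
  apply/integrableP; split => //.
  by under eq_integral => x /set_mem Dx do rewrite gee0_abs ?G0//.
have FGle : (\int[mu]_(x in D) F x <= \int[mu]_(x in D) G x)%E by exact: ae_ge0_le_integral.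
have iF : mu.-integrable D F.
  apply/integrableP; split => //.
  under eq_integral => x /set_mem Dx do rewrite gee0_abs ?F0//.
  exact: le_lt_trans Goo.
have iGF : mu.-integrable D (G \- F)%E by exact: integrableB.
have mGF := measurable_int _ iGF.
have : (\int[mu]_(x in D) `|(G \- F)%E x|%E = 0)%E.
  transitivity (\int[mu]_(x in D) (G \- F)%E x)%E.
    apply: ae_eq_integral => //; first exact: measurableT_comp.
    apply: filterS2 FG (integrable_ae mD iF) => x FGx Ffin Dx.
    by have Fx := Ffin Dx; rewrite gee0_abs//= sube_ge0 ?Fx//; exact: FGx.
  rewrite integralB//.
  have -> : (\int[mu]_(x in D) F x = \int[mu]_(x in D) G x)%E.
    by apply/eqP; rewrite eq_le FGle GF.
  by rewrite subee// integrable_fin_num.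
move=> /(ae_eq_integral_abs _ mD mGF).
apply: filterS2 (integrable_ae mD iF) => x Ffin GF0 Dx.
move: (Ffin Dx) (GF0 Dx) => /=; case: (F x) => // r _; case: (G x) => // g [].
by move=> /subr0_eq ->.
Qed.

End ae_tools.

Section transfer.
Context {R : realType} (q : R).
Hypothesis q1 : 1 < q.
Let q0 : 0 < q. Proof. exact: lt_trans q1. Qed.
Local Notation mu := (@lebesgue_measure R).
Local Notation br := (branch q).
Local Notation jac := (branch_weight q).
Local Notation pf := (perron_frobenius q).
Local Notation ext := (patch (fun=> 0) I01).

(** The branches are nonsingular: the Perron-Frobenius operator applied to the
    indicator of a null set has integral zero, so almost everywhere every term
    of its series vanishes. *)
Lemma ae_branch (P : R -> Prop) :
  {ae mu, forall x, I01 x -> P x} ->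
  {ae mu, forall x, I01 x -> forall n, br n.+1 x < 1 -> P (br n.+1 x)}.
Proof.
move=> [N [mN N0 PN]].
pose F := (fun x => (\1_(N `&` I01) x)%:E) : R -> \bar R.
have mI : measurable (I01 : set R) by exact: measurable_itv.
have mNI : measurable (N `&` (I01 : set R)) by exact: measurableI.
have mF : measurable_fun setT F by exact/measurable_EFinP/measurable_indic.
have F0 x : (0 <= F x)%E by rewrite lee_fin.
have F01 (x : R) : ~ I01 x -> F x = 0%E
  by move=> nI; rewrite /F indicE memNset// => -[_ /nI].
have : (\int[mu]_(x in I01) pf F x = 0)%E.
  rewrite integral_pf// /F integral_indic//.
  apply/eqP; rewrite eq_le measure_ge0 andbT -N0; apply: le_measure; rewrite ?inE//.
    exact: measurableI.
  by move=> x [[]].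
have pF0 (x : R) : (0 <= pf F x)%E by exact: pf_ge0.
move=> intF.
have : (\int[mu]_(x in I01) `|pf F x|%E = 0)%E.
  by rewrite -[RHS]intF; apply: eq_integral => x _; rewrite gee0_abs.
have mpF : measurable_fun (I01 : set R) (pf F).
  by apply: measurable_funTS; exact: measurable_pf.
move=> h0; have := (@ae_eq_integral_abs _ _ _ mu _ mI _ mpF).1 h0.
apply: filterS => x pFx Ix n yn.
have /I01E/andP[x0 x1] := Ix.
have Iy : I01 (br n.+1 x) by apply/I01E; rewrite branch_gt0 ?ltW.
apply: contrapT => nP.
have Ny : (N `&` I01) (br n.+1 x) by split => //; apply: PN => /= /(_ Iy).
have := pFx Ix; rewrite /= pfE// => sum0.
have := @nneseries_term_le _ (fun n => (jac n.+1 x)%:E * F (br n.+1 x))%E n.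
rewrite sum0 /F indicE mem_set// mule1 lee_fin leNgt branch_weight_gt0 ?ltW//=.
move=> /(_ (fun k => _)) h; suff : false by [].
by apply: h => k; rewrite mule_ge0// lee_fin ltW// branch_weight_gt0// ltW.
Qed.

Lemma pf_branch_lty (g : R -> \bar R) x n : (forall z, (0 <= g z)%E) -> I01 x ->
  (pf g x < +oo)%E -> (g (br n.+1 x) < +oo)%E.
Proof.
move=> g0 Ix goo; have /I01E/andP[x0 _] := Ix.
have jac0 k : 0 < jac k.+1 x by rewrite branch_weight_gt0// ltW.
have := @nneseries_term_le _ (fun k => (jac k.+1 x)%:E * g (br k.+1 x))%E n.
rewrite -pfE// => term; rewrite ltNge leye_eq; apply/negP => /eqP gy; move: goo.
rewrite ltNge => /negP; apply; rewrite (le_trans _ (term _))//.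
  by rewrite gy gt0_muley// lte_fin.
by move=> k; rewrite mule_ge0// lee_fin ltW.
Qed.

Definition transfer_term (w : R[i]) (G : R -> R[i]) (y : R) (n : nat) : R[i] :=
  w ^+ n.+1 * (jac n.+1 y)%:C * ext G (br n.+1 y).

(** Convergence is recorded along with the value, since a limit is a meaningful
    sum, and hence linear, only when it exists. *)
Definition transfer_to (w : R[i]) (G : R -> R[i]) (y : R) (s : R[i]) :=
  (fun n => \sum_(k < n) transfer_term w G y k : R[i]^o) @ \oo --> (s : R[i]^o).

Lemma transfer_toE w G y s : transfer_to w G y s -> transfer w q G y = s.
Proof.
move=> as_; rewrite /transfer.
apply: (@cvg_lim (R[i]^o) (@norm_hausdorff _ (R[i]^o)) nat).
rewrite -(cvg_shiftS (fun n => \sum_(1 <= k < n) _)).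
by under eq_fun do rewrite big_add1/= big_mkord.
Qed.

(** The three parts are convergence, the contraction estimate, and its equality
    case: if the modulus of the value reaches the bound, then every term whose
    bound is positive attains it and carries the common phase. *)
Lemma transfer_bound (w : R[i]) (G : R -> R[i]) (g : R -> \bar R) (y : R) :
  `|w| = 1 -> I01 y -> (forall z, (0 <= g z)%E) ->
  (forall n, ((cabs (ext G (br n.+1 y)))%:E <= g (br n.+1 y))%E) ->
  (pf g y < +oo)%E ->
  [/\ transfer_to w G y (transfer w q G y),
   cabs (transfer w q G y) <= fine (pf g y) &
   (0 < fine (pf g y) -> fine (pf g y) <= cabs (transfer w q G y) ->
   forall n, br n.+1 y < 1 -> (0 < g (br n.+1 y))%E ->
     (cabs (G (br n.+1 y)))%:E = g (br n.+1 y) /\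
     w ^+ n.+1 * csign (G (br n.+1 y)) = csign (transfer w q G y))].
Proof.
move=> w1 Iy g0 Gg goo; have /I01E/andP[y0 y1] := Iy.
have jac0 n : 0 < jac n.+1 y by rewrite branch_weight_gt0// ltW.
have term_ge0 n : (0 <= (jac n.+1 y)%:E * g (br n.+1 y))%E.
  by rewrite mule_ge0// lee_fin ltW.
have gfin n : g (br n.+1 y) \is a fin_num.
  by rewrite ge0_fin_numE//; exact: pf_branch_lty goo.
pose c n := jac n.+1 y * fine (g (br n.+1 y)).
have cE n : (c n)%:E = ((jac n.+1 y)%:E * g (br n.+1 y))%E by rewrite /c EFinM fineK.
have c0 n : 0 <= c n by rewrite -lee_fin cE.
have cC : (\sum_(k < n) c k) @[n --> \oo] --> fine (pf g y).
  apply: cvg_nneseries_fine => //.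
  by rewrite pfE//; apply: eq_eseriesr => n _; exact: cE.
pose a := transfer_term w G y.
have ac n : cabs (a n) <= c n.
  rewrite /a /transfer_term cabsM cabs_unit; last by rewrite normrX w1 expr1n.
  rewrite cabs_real (gtr0_norm (jac0 n)) /c ler_pM2l//.
  by rewrite -lee_fin fineK.
have [s as_] := complex_series_cvg ac cC.
have sE : transfer w q G y = s by exact: transfer_toE as_.
rewrite sE; have sC := complex_series_le ac cC as_; split => //.
move=> pf0 pfs n ny gn.
have := complex_series_phase ac cC as_ n pfs.
have In : I01 (br n.+1 y) by apply/I01E; rewrite branch_gt0 ?ltW.
rewrite /a /transfer_term /patch mem_set// => aE.
have s0 : s != 0 by rewrite -cabs_eq0 gt_eqF//; exact: lt_le_trans pfs.
have gn' : 0 < fine (g (br n.+1 y)) by rewrite fine_gt0// gn/= -ge0_fin_numE.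
have hw : cabs (w ^+ n.+1) = 1 by rewrite /cabs normrX w1 expr1n.
have hs : cabs (csign s) = 1 by rewrite /cabs normr_csign.
have cG : cabs (G (br n.+1 y)) = fine (g (br n.+1 y)).
  have := congr1 (@cabs R) aE.
  rewrite (cabsM _ (G _)) (cabsM (w ^+ _)) (cabsM _ (csign s)) hw hs !cabs_real.
  rewrite mul1r mulr1.
  rewrite (gtr0_norm (jac0 n)) gtr0_norm; last by rewrite /c mulr_gt0.
  by move=> /mulfI -> //; rewrite gt_eqF.
split; first by rewrite cG fineK.
have Gn0 : 0 < cabs (G (br n.+1 y)) by rewrite cG.
have k0 : (jac n.+1 y)%:C * (cabs (G (br n.+1 y)))%:C != 0.
  by rewrite -rmorphM/= (inj_eq (@complexI R)) gt_eqF// mulr_gt0.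
apply: (mulfI k0).
transitivity (w ^+ n.+1 * (jac n.+1 y)%:C * G (br n.+1 y)).
  by rewrite -[in RHS](csignE (G _)); ring.
by rewrite aE /c -cG rmorphM.
Qed.

End transfer.

(** * Eigenfunctions have no cancellation *)

Section eigenfunction.
Context {R : realType} (q : R).
Hypothesis q1 : 1 < q.
Let q0 : 0 < q. Proof. exact: lt_trans q1. Qed.
Local Notation mu := (@lebesgue_measure R).
Local Notation br := (branch q).
Local Notation jac := (branch_weight q).
Local Notation pf := (perron_frobenius q).
Local Notation ext := (patch (fun=> 0) I01).

Let mI : measurable (I01 : set R). Proof. exact: measurable_itv. Qed.

Let mIR : measurable (I01 : set (measurableTypeR R)). Proof. exact: measurable_itv. Qed.

(** The modulus of [h], extended by zero off (0,1), in the form to which the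
    Perron-Frobenius operator applies. *)
Definition modulus (h : R -> R[i]) (x : R) : \bar R := (cabs (ext h x))%:E.

Lemma modulus_ge0 h x : (0 <= modulus h x)%E.
Proof. by rewrite lee_fin cabs_ge0. Qed.

Lemma modulusE h x : I01 x -> modulus h x = (cabs (h x))%:E.
Proof. by move=> Ix; rewrite /modulus /patch mem_set. Qed.

Lemma modulus_out h x : ~ I01 x -> modulus h x = 0%E.
Proof. by move=> nI; rewrite /modulus /patch memNset// cabs0. Qed.

Lemma measurable_modulus h : L1 h -> measurable_fun setT (modulus h).
Proof.
move=> [/integrableP[/measurable_EFinP mr _] /integrableP[/measurable_EFinP mi _]].
have -> : modulus h =
    (fun x => (Num.sqrt (complex.Re (h x) ^+ 2 + complex.Im (h x) ^+ 2))%:E) \_ I01.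
  apply/funext => x; rewrite /modulus /patch; case: ifP => _; last by rewrite cabs0.
  by rewrite cabs_sqrt.
apply/(measurable_restrictT _ mI)/measurable_EFinP.
apply: (@measurableT_comp _ _ _ _ _ _ (@Num.sqrt R)).
  apply: continuous_measurable_fun; exact: sqrt_continuous.
by apply: measurable_funD; apply: measurable_funX.
Qed.

Lemma integral_modulus_lty h : L1 h -> (\int[mu]_(x in I01) modulus h x < +oo)%E.
Proof.
move=> Lh; have [ir ii] := Lh.
have := integrableD mIR (integrable_abse ir) (integrable_abse ii).
move=> /integrableP[_]; apply: le_lt_trans.
apply: ge0_le_integral => //.
- by move=> x _; exact: modulus_ge0.
- by apply: measurable_funTS; exact: measurable_modulus.
- apply: measurableT_comp => //; apply: emeasurable_funD; apply: measurableT_comp => //.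
    exact: measurable_int ir.
  exact: measurable_int ii.
- move=> x Ix; rewrite modulusE//= lee_fin.
  by rewrite (le_trans (cabs_le_ReIm _))// ler_norm.
Qed.

Variables (h : R -> R[i]) (zeta eta lambda : R[i]).
Hypotheses (Lh : L1 h) (z1 : `|zeta| = 1) (e1 : `|eta| = 1) (l1 : `|lambda| = 1).

Local Notation f := (modulus h).
Let mf : measurable_fun setT f. Proof. exact: measurable_modulus. Qed.
Let f0 x : (0 <= f x)%E. Proof. exact: modulus_ge0. Qed.
Let f01 x : ~ I01 x -> f x = 0%E. Proof. exact: modulus_out. Qed.
Let mpf : measurable_fun setT (pf f). Proof. exact: measurable_pf. Qed.
Let pf0 x : (0 <= pf f x)%E. Proof. exact: pf_ge0. Qed.
Let pf01 x : ~ I01 x -> pf f x = 0%E. Proof. exact: pf_out. Qed.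

Lemma transfer_modulus_bound y : I01 y -> (pf f y < +oo)%E ->
  [/\ transfer_to q eta h y (transfer eta q h y),
   cabs (transfer eta q h y) <= fine (pf f y) &
   (0 < fine (pf f y) -> fine (pf f y) <= cabs (transfer eta q h y) ->
   forall n, br n.+1 y < 1 -> (0 < f (br n.+1 y))%E ->
     (cabs (h (br n.+1 y)))%:E = f (br n.+1 y) /\
     eta ^+ n.+1 * csign (h (br n.+1 y)) = csign (transfer eta q h y))].
Proof. by move=> Iy; apply: (transfer_bound q1). Qed.

(** The contraction estimate at the outer level: the modulus of the inner
    transform is itself bounded by the Perron-Frobenius operator, where finite. *)
Lemma Q_modulus_bound x : I01 x -> (pf (pf f) x < +oo)%E ->
  [/\ transfer_to q zeta (transfer eta q h) x (Q q zeta eta h x),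
   cabs (Q q zeta eta h x) <= fine (pf (pf f) x) &
   (0 < fine (pf (pf f) x) -> fine (pf (pf f) x) <= cabs (Q q zeta eta h x) ->
   forall n, br n.+1 x < 1 -> (0 < pf f (br n.+1 x))%E ->
     (cabs (transfer eta q h (br n.+1 x)))%:E = pf f (br n.+1 x) /\
     zeta ^+ n.+1 * csign (transfer eta q h (br n.+1 x)) = csign (Q q zeta eta h x))].
Proof.
move=> Ix; apply: (transfer_bound q1) => // n.
set y := br n.+1 x; rewrite /patch; case: ifPn => [/set_mem Iy|_]; last by rewrite cabs0.
have [pfy|] := ltP (pf f y) +oo%E; last by rewrite leye_eq => /eqP ->; rewrite leey.
have [_ + _] := transfer_modulus_bound Iy pfy.
by rewrite -lee_fin fineK// ge0_fin_numE.
Qed.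

Lemma integral_pf_pf :
  (\int[mu]_(x in I01) pf (pf f) x = \int[mu]_(x in I01) f x)%E.
Proof. by rewrite !integral_pf. Qed.

Let mppf : measurable_fun (I01 : set R) (pf (pf f)).
Proof. by apply: measurable_funTS; exact: measurable_pf. Qed.

Let ppf0 x : (0 <= pf (pf f) x)%E. Proof. exact: pf_ge0. Qed.

Lemma ae_pf_pf_lty : {ae mu, forall x, I01 x -> (pf (pf f) x < +oo)%E}.
Proof.
have ippf : mu.-integrable I01 (pf (pf f)).
  apply/integrableP; split => //.
  under eq_integral do rewrite gee0_abs//; rewrite integral_pf_pf.
  exact: integral_modulus_lty.
apply: ae_imply (integrable_ae mIR ippf) => x fin Ix.
by have := fin Ix; rewrite ge0_fin_numE.
Qed.

Hypothesis hQ : ae01 (fun x => Q q zeta eta h x - lambda * h x) (fun=> 0).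

Let hQ' : {ae mu, forall x, I01 x -> Q q zeta eta h x = lambda * h x}.
Proof.
have H : {ae mu, forall x, I01 x -> Q q zeta eta h x - lambda * h x = 0} := hQ.
by apply: ae_imply H => x hx Ix; exact: subr0_eq (hx Ix).
Qed.

(** The contraction estimate gives one inequality, and both sides have the same
    finite integral. *)
Lemma ae_modulus_fixed : {ae mu, forall x, I01 x -> f x = pf (pf f) x}.
Proof.
apply: ae_eq_of_le_integral => //.
- exact: measurable_funTS.
- apply: ae_imply2 ae_pf_pf_lty hQ' => x fin hx Ix.
  have ppfx := fin Ix; have [_ + _] := Q_modulus_bound Ix ppfx.
  rewrite (hx Ix) cabs_unit// -lee_fin fineK ?ge0_fin_numE//.
  by rewrite modulusE.
- by rewrite integral_pf_pf; exact: integral_modulus_lty.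
- by rewrite integral_pf_pf.
Qed.

(** The modulus of [Q h] equals its bound at x, so the equality case applies to
    the outer series.  As h does not vanish at the point reached, the inner value
    at the intermediate point is not zero and attains its own bound, so the
    equality case applies to the inner series too. *)
Lemma phase_relation : {ae mu, forall x, I01 x -> forall m n,
  br m.+1 x < 1 -> br n.+1 (br m.+1 x) < 1 -> h (br n.+1 (br m.+1 x)) != 0 ->
  lambda * csign (h x) = zeta ^+ m.+1 * eta ^+ n.+1 * csign (h (br n.+1 (br m.+1 x)))}.
Proof.
apply: ae_imply2 ae_modulus_fixed hQ' => x fx hx Ix m n.
set y := br m.+1 x; set z := br n.+1 y => y1 zz1 hz.
have {}hx := hx Ix.
have {}fx := fx Ix; rewrite modulusE// in fx.
have ppfx : (pf (pf f) x < +oo)%E by rewrite -fx ltry.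
have [_ _ out] := Q_modulus_bound Ix ppfx.
have /I01E/andP[x0 x1] := Ix.
have y0 : 0 < y by rewrite branch_gt0 ?ltW.
have zz0 : 0 < z by rewrite branch_gt0 ?ltW.
have Iy : I01 y by apply/I01E; rewrite y0.
have Iz : I01 z by apply/I01E; rewrite zz0.
have fz : (0 < f z)%E.
  by rewrite modulusE// lte_fin lt_neqAle cabs_ge0 andbT eq_sym cabs_eq0.
have pfy : (0 < pf f y)%E.
  rewrite pfE//; pose u k := ((jac k.+1 y)%:E * f (br k.+1 y))%E.
  apply: lt_le_trans (@nneseries_term_le _ u n _).
    by rewrite mule_gt0// lte_fin branch_weight_gt0// ltW.
  by move=> k; rewrite mule_ge0// lee_fin ltW// branch_weight_gt0// ltW.
have term := @nneseries_term_le _ (fun k => (jac k.+1 x)%:E * pf f (br k.+1 x))%E m.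
rewrite -pfE// -fx in term.
have {}term : ((jac m.+1 x)%:E * pf f y <= (cabs (h x))%:E)%E.
  by apply: term => k; rewrite mule_ge0// lee_fin ltW// branch_weight_gt0// ltW.
have jx : 0 < jac m.+1 x by rewrite branch_weight_gt0// ltW.
have hx0 : 0 < cabs (h x).
  by rewrite -lte_fin; apply: lt_le_trans term; rewrite mule_gt0.
have pfyoo : (pf f y < +oo)%E.
  rewrite ltNge leye_eq; apply/negP => /eqP E; move: term.
  by rewrite E gt0_muley// leye_eq.
rewrite -fx/= hx cabs_unit// in out.
have [cg sg] := out hx0 (lexx _) m y1 pfy.
have [_ _ inn] := transfer_modulus_bound Iy pfyoo.
have fp : 0 < fine (pf f y) by rewrite fine_gt0// pfy.
have fle : fine (pf f y) <= cabs (transfer eta q h y) by rewrite -cg.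
have [_ sz] := inn fp fle n zz1 fz.
by rewrite -csign_unit// -sg -sz mulrA.
Qed.

End eigenfunction.

(** * Phases along words *)

Section rigidity.
Context {R : realType} (q : R).
Hypothesis q1 : 1 < q.
Let q0 : 0 < q. Proof. exact: lt_trans q1. Qed.
Local Notation mu := (@lebesgue_measure R).
Local Notation br := (branch q).
Local Notation psi := (word_map q).
Local Notation valid := (word_valid q).
Local Notation valid_on := (valid_on q).
Local Notation mass := (word_mass q).
Local Notation len := (mass (fun=> 1)).
Local Notation pos := (all (fun n => 0 < n)%N).
Implicit Types (s : seq nat).

(** Prepending one full branch to an odd word makes it even, at the price of
    a constant factor. *)
Lemma even_words_suffice (F : R -> R) (K delta : R) :
  measurable_fun setT F -> (forall x, 0 <= F x) -> (forall x, F x <= K) -> 0 <= delta ->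
  (forall s, ~~ odd (size s) -> valid_on s 0 1 -> delta * len s 0 1 <= mass F s 0 1) ->
  exists2 k, 0 < k & forall s, valid_on s 0 1 -> k * delta * len s 0 1 <= mass F s 0 1.
Proof.
move=> mF F0 FK d0 H.
have [N N0 /andP[_ qN]] := nat_ceil q1.
have N1 : 0 < N.+1%:R :> R by rewrite ltr0n.
pose a := q / N.+2%:R; pose b := q / N.+1%:R.
have a0 : 0 < a by rewrite divr_gt0// ltr0n.
have ab : a < b by rewrite ltr_pM2l// ltf_pV2 ?posrE ?ltr0n// ltr_nat.
have b1 : b <= 1 by rewrite ler_pdivrMr// mul1r.
have ba1 : b - a <= 1 by lra.
have ba0 : 0 < b - a by rewrite subr_gt0.
exists ((b - a) / 4); first by rewrite divr_gt0.
move=> s vs; have s0 : pos s by exact: valid_on_pos vs.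
have len0 : 0 <= len s 0 1 by apply: mass_ge0.
have [os|es] := boolP (odd (size s)); last first.
  apply: le_trans (H s es vs); rewrite -mulrA ler_piMl ?mulr_ge0//; lra.
have sub (G : R -> R) : measurable_fun setT G -> (forall x, 0 <= G x) ->
    mass G s a b = mass G (N.+1 :: s) 0 1.
  move=> mG G0; rewrite -mass_cons//.
  by rewrite /branch addr0 natr1.
have vab : valid_on (N.+1 :: s) 0 1.
  move=> x x0 x1; rewrite /=; have bx : br N.+1 x < b.
    by rewrite /branch ltr_pM2l// ltf_pV2 ?posrE ?addr_gt0// ltrDl.
  rewrite (lt_le_trans bx)//=; apply: vs; last exact: lt_le_trans bx _.
  by rewrite branch_gt0// ltW.
have := H (N.+1 :: s); rewrite /= os => /(_ isT vab).
rewrite -(sub (fun=> 1) (measurable_cst _) (fun=> ler01)) -(sub F mF F0) => h.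
have sb : mass F s a b <= mass F s 0 1 by apply: (mass_sub q0 mF F0 FK) => //; exact: ltW.
apply: le_trans sb; apply: le_trans h.
have := @len_distortion _ _ q1 s 0 1 a b ((b - a)^-1) s0 (lexx 0) ler01 (ltW a0) ab b1.
rewrite subr0 mulVf ?gt_eqF// => /(_ (lexx 1)) h.
have := ler_wpM2l d0 (ler_wpM2l (ltW ba0) h).
rewrite (_ : (b - a) * (4 * _ * _) = 4 * len s a b); last by field; rewrite gt_eqF.
by move=> h'; lra.
Qed.

Variables (h : R -> R[i]) (zeta eta lambda : R[i]).
Hypotheses (Lh : L1 h) (z1 : `|zeta| = 1) (e1 : `|eta| = 1) (l1 : `|lambda| = 1).
Hypothesis hQ : ae01 (fun x => Q q zeta eta h x - lambda * h x) (fun=> 0).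

(** The operator [Q] consumes two branches at a time, hence even words. *)
Lemma word_relation s : ~~ odd (size s) -> exists2 c : R[i], `|c| = 1 &
  {ae mu, forall x, I01 x -> valid s x -> h (psi s x) != 0 ->
     csign (h x) = c * csign (h (psi s x))}.
Proof.
have [k] := ubnP (size s); elim: k s => // k IH [|m [|n s]]//= sk es.
  by exists 1; [rewrite normr1|apply: aeW => x _ _ _; rewrite mul1r].
have [||c c1 Hc] := IH s; [by move: sk; rewrite ltnS => /ltnW|by rewrite negbK in es|].
exists (lambda^-1 * zeta ^+ m * eta ^+ n * c).
  by rewrite !normrM normfV !normrX l1 z1 e1 c1 !expr1n invr1 !mulr1.
have Hn := ae_branch q1 (ae_branch q1 Hc).
apply: ae_imply2 Hn (phase_relation q1 Lh z1 e1 l1 hQ) => x Hx Px Ix.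
case: m => // m; case: n => [|n] /=; first by rewrite andbF.
move=> /andP[y1 /andP[zz1 vz]] hz.
have hE := Hx Ix m y1 n zz1 vz hz.
have hz0 : h (br n.+1 (br m.+1 x)) != 0.
  rewrite -csign_eq0 hE mulf_eq0 negb_or csign_eq0 hz andbT -normr_eq0 c1.
  exact: oner_neq0.
have l0 : lambda != 0 by rewrite -normr_eq0 l1 oner_neq0.
apply: (mulfI l0); rewrite (Px Ix m n y1 zz1 hz0) hE !mulrA.
by rewrite mulfV// mul1r.
Qed.

End rigidity.

(** * Constants and Lebesgue points *)

Section constants.
Context {R : realType}.
Local Notation mu := (@lebesgue_measure R).

(** The constant can only be the mean [k0] of [v]: if [v] is within e of k in mean,
    then so is [k0], and [v] is within 2 e of [k0]. *)
Lemma ae_constant_of_approx (v : R -> R) : measurable_fun (I01 : set R) v ->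
  (forall x, `|v x| <= 1) ->
  (forall e : R, 0 < e -> exists k : R, (\int[mu]_(x in I01) `|v x - k|%:E <= e%:E)%E) ->
  exists k, {ae mu, forall x, I01 x -> v x = k}.
Proof.
move=> mv v1 approx.
have mI : measurable (I01 : set (measurableTypeR R)) by exact: measurable_itv.
have muI : mu I01 = 1%E by rewrite /I01 lebesgue_measure_itv/= lte01 oppr0 adde0.
have muIoo : (mu I01 < +oo)%E by rewrite muI ltry.
have mvk k : measurable_fun (I01 : set (measurableTypeR R)) (fun x => v x - k).
  by apply: measurable_funB => //; exact: measurable_cst.
have ik k : mu.-integrable I01 (EFin \o (fun x => v x - k)).
  apply: measurable_bounded_integrable => //.
  exists (1 + `|k|); split; first exact: num_real.
  move=> M kM x _ /=; apply: (le_trans (ler_normB _ _)).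
  by apply: le_trans (ltW kM); rewrite lerD2r.
have iN k : mu.-integrable I01 (EFin \o (fun x => `|v x - k|)).
  exact: (integrable_norm (ik k)).
have iv : mu.-integrable I01 (EFin \o v).
  by apply: eq_integrable (ik 0) => // x _; rewrite /= subr0.
have icst (k : R) : mu.-integrable I01 (EFin \o (fun _ : R => k)).
  apply: measurable_bounded_integrable => //.
  exact: bounded_cst.
pose N k : R := (\int[mu]_(x in I01) `|v x - k|)%R.
have NE k : (N k)%:E = (\int[mu]_(x in I01) `|v x - k|%:E)%E.
  rewrite /N /Rintegral fineK//; apply: integrable_fin_num => //.
  exact: iN.
pose k0 : R := (\int[mu]_(x in I01) v x)%R.
have k0N k : `|k0 - k| <= N k.
  have -> : k0 - k = (\int[mu]_(x in I01) (v x - k))%R.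
    by rewrite RintegralB// Rintegral_cst//= muI mulr1.
  exact: le_normr_Rintegral.
have N0 : N k0 = 0.
  apply/eqP; rewrite eq_le; apply/andP; split; last by apply: Rintegral_ge0.
  apply/ler_addgt0Pr => e e0; rewrite add0r.
  have [|k] := approx (e / 2); first by rewrite divr_gt0.
  rewrite -NE lee_fin => Nk.
  rewrite [e]splitr; apply: (@le_trans _ _ (N k + `|k0 - k|)); last first.
    by rewrite lerD// (le_trans (k0N k)).
  have -> : `|k0 - k| = (\int[mu]_(x in I01) `|k0 - k|)%R.
    by rewrite Rintegral_cst//= muI mulr1.
  rewrite -RintegralD//.
  apply: le_Rintegral => //.
  - by have := integrableD mI (iN k) (icst `|k0 - k|); apply.
  - move=> x _; rewrite (_ : v x - k0 = (v x - k) - (k0 - k)); last by ring.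
    exact: ler_normB.
exists k0.
have mE : measurable_fun (I01 : set (measurableTypeR R)) (fun x => (v x - k0)%:E).
  exact/measurable_EFinP.
have : (\int[mu]_(x in I01) `|(v x - k0)%:E| = 0)%E by rewrite -NE N0.
move=> /(ae_eq_integral_abs _ mI mE).
by apply: ae_imply => x hx Ix; move: (hx Ix) => /= [] /subr0_eq.
Qed.

(** At a Lebesgue point the mean oscillation over small centred intervals tends to
    zero; here it is multiplied out, 2 r being the length of the interval. *)
Lemma lebesgue_pt_small (v : R -> R) (y e : R) : lebesgue_pt v y -> 0 < e ->
  \forall r \near (0:R)^'+,
    (\int[mu]_(x in `](y - r)%R, (y + r)%R[) `|(v x - v y)%R|%:E <= (e * (r *+ 2))%:E)%E.
Proof.
move=> vy e0; have := vy; rewrite /lebesgue_pt => /fine_cvgP[fin].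
move=> /cvgrPdist_lt /(_ e e0) H.
near=> r.
have r0 : 0 < r by [].
have r20 : 0 < r *+ 2 by rewrite mulrn_wgt0.
have fr : davg v y r \is a fin_num by near: r.
have : `|0 - fine (davg v y r)| < e by near: r.
rewrite sub0r normrN ger0_norm ?fine_ge0 ?davg_ge0//.
rewrite -lte_fin fineK// /davg /iavg (lebesgue_measure_ball _ (ltW r0)).
rewrite inver gt_eqF// muleC lte_pdivrMr//= => /ltW.
by rewrite -ball_itv EFinM.
Unshelve. all: by end_near. Qed.

End constants.

(** * Rigidity of the phase *)

Section phase_constant.
Context {R : realType} (q : R).
Hypothesis q1 : 1 < q.
Let q0 : 0 < q. Proof. exact: lt_trans q1. Qed.
Local Notation mu := (@lebesgue_measure R).
Local Notation br := (branch q).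
Local Notation psi := (word_map q).
Local Notation wt := (word_weight q).
Local Notation valid := (word_valid q).
Local Notation valid_on := (valid_on q).
Local Notation mass := (word_mass q).
Local Notation len := (mass (fun=> 1)).
Local Notation pos := (all (fun n => 0 < n)%N).
Local Notation ext := (patch (fun=> 0) I01).
Local Notation Re := (@complex.Re R).
Local Notation Im := (@complex.Im R).
Implicit Types (s : seq nat).

Let mI : measurable (I01 : set R). Proof. exact: measurable_itv. Qed.

Let mIR : measurable (I01 : set (measurableTypeR R)). Proof. exact: measurable_itv. Qed.

Lemma word_map_I01 s x : valid s x -> I01 x -> I01 (psi s x).
Proof.
elim: s x => //= n s IH x /and3P[n0 nx vx] /I01E/andP[x0 x1].
by apply: IH => //; apply/I01E; rewrite nx branch_gt0// ltW.
Qed.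

Definition phase (h : R -> R[i]) (x : R) : R[i] := csign (ext h x).

Lemma phaseE h x : I01 x -> phase h x = csign (h x).
Proof. by move=> Ix; rewrite /phase /patch mem_set. Qed.

Lemma cabs_csign (z : R[i]) : cabs (csign z) <= 1.
Proof.
rewrite -lecR cabsE; have [->|z0] := eqVneq z 0; first by rewrite csign0 normr0 ler01.
by rewrite normr_csign.
Qed.

Lemma Re_phase_le h x : `|Re (phase h x)| <= 1.
Proof. by apply: le_trans (normRe_cabs _) (cabs_csign _). Qed.

Lemma Im_phase_le h x : `|Im (phase h x)| <= 1.
Proof. by apply: le_trans (normIm_cabs _) (cabs_csign _). Qed.

(** Division by a real number acts on real and imaginary parts separately, which
    reduces measurability of the phase to that of [h]. *)
Lemma csign_scale (z : R[i]) : csign z = z * ((cabs z)^-1)%:C.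
Proof. by rewrite /csign -cabsE fmorphV. Qed.

Let measurable_part (P : R[i] -> R) h : P 0 = 0 ->
  (forall z (r : R), P (z * r%:C) = P z * r) ->
  measurable_fun (I01 : set R) (fun x => P (h x)) -> L1 h ->
  measurable_fun setT (fun x => P (phase h x)).
Proof.
move=> P0 PZ mP Lh.
have -> : (fun x => P (phase h x)) =
    (fun x => P (ext h x) * (cabs (ext h x) `^ (-1))).
  by apply/funext => x; rewrite /phase csign_scale PZ powR_inv1// cabs_ge0.
apply: measurable_funM.
  have -> : (fun x => P (ext h x)) = (fun x => P (h x)) \_ I01.
    by apply/funext => x; rewrite /patch; case: ifP.
  exact/(measurable_restrictT _ mI).
apply: (@measurableT_comp _ _ _ _ _ _ (fun a : R => a `^ (-1))).
  exact: measurable_powR.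
by have /measurable_EFinP := measurable_modulus Lh.
Qed.

Lemma measurable_Re_phase h : L1 h -> measurable_fun setT (fun x => Re (phase h x)).
Proof.
move=> Lh; apply: measurable_part => //.
- by move=> [a b] r /=; ring.
- by have [/integrableP[/measurable_EFinP]] := Lh.
Qed.

Lemma measurable_Im_phase h : L1 h -> measurable_fun setT (fun x => Im (phase h x)).
Proof.
move=> Lh; apply: measurable_part => //.
- by move=> [a b] r /=; ring.
- by have [_ /integrableP[/measurable_EFinP]] := Lh.
Qed.

Let locally_integrable_part (v : R -> R) : measurable_fun setT v ->
  (forall x, `|v x| <= 1) -> (forall x, ~ I01 x -> v x = 0) ->
  locally_integrable setT v.
Proof.
move=> mv v1 v0; apply: open_integrable_locally; first exact: openT.
have -> : EFin \o v = (EFin \o v) \_ I01.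
  apply/funext => x; rewrite patchE; case: ifPn => // /negP xI /=.
  by rewrite v0// => /mem_set.
apply/(integrable_mkcond _ mIR).
apply: measurable_bounded_integrable => //.
- by rewrite /= /I01 lebesgue_measure_itv/= lte01 oppr0 adde0 ltry.
- exact: measurable_funTS.
- exists 1; split; first exact: num_real.
  by move=> M M1 x _ /=; rewrite (le_trans (v1 x))// ltW.
Qed.

Variables (h : R -> R[i]) (zeta eta lambda : R[i]).
Hypotheses (Lh : L1 h) (z1 : `|zeta| = 1) (e1 : `|eta| = 1) (l1 : `|lambda| = 1).
Hypothesis hQ : ae01 (fun x => Q q zeta eta h x - lambda * h x) (fun=> 0).
Hypothesis hN0 : ~ ae01 h (fun=> 0).

(** Almost every point is a Lebesgue point of both parts of the phase, so if there
    were none with [h y != 0], then [h] would vanish almost everywhere. *)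
Lemma regular_point : exists y, [/\ I01 y, h y != 0,
  lebesgue_pt (fun x => Re (phase h x)) y & lebesgue_pt (fun x => Im (phase h x)) y].
Proof.
apply: contrapT => nE; apply: hN0.
have phase0 x : ~ I01 x -> phase h x = 0 by move=> nI; rewrite /phase /patch memNset// csign0.
have LR := lebesgue_differentiation (locally_integrable_part (measurable_Re_phase Lh)
  (Re_phase_le h) (fun x nI => congr1 Re (phase0 x nI))).
have LI := lebesgue_differentiation (locally_integrable_part (measurable_Im_phase Lh)
  (Im_phase_le h) (fun x nI => congr1 Im (phase0 x nI))).
apply: ae_imply2 LR LI => y Ry Iy I01y; apply: contrapT => hy; apply: nE.
by exists y; split => //; exact/eqP.
Qed.

(** The deviations of the real and imaginary parts are added, instead of taking
    the comparable modulus of the difference, because Lebesgue points are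
    available for real-valued functions. *)
Definition deviation (y x : R) : R :=
  `|Re (phase h x) - Re (phase h y)| + `|Im (phase h x) - Im (phase h y)|.

Lemma measurable_deviation y : measurable_fun setT (deviation y).
Proof.
apply: measurable_funD; apply: measurableT_comp => //;
  apply: measurable_funB; do ?exact: measurable_cst.
exact: measurable_Re_phase.
exact: measurable_Im_phase.
Qed.

Lemma deviation_ge0 y x : 0 <= deviation y x. Proof. exact: addr_ge0. Qed.

Lemma deviation_le4 y x : deviation y x <= 4.
Proof.
have := Re_phase_le h x; have := Re_phase_le h y.
have := Im_phase_le h x; have := Im_phase_le h y.
rewrite /deviation; have := ler_normB (Re (phase h x)) (Re (phase h y)).
have := ler_normB (Im (phase h x)) (Im (phase h y)); lra.
Qed.

Lemma cabs_le_deviation y x : cabs (phase h x - phase h y) <= deviation y x.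
Proof. by apply: le_trans (cabs_le_ReIm _) _; rewrite Re_sub Im_sub. Qed.

(** If the mean deviation were at least delta over every full cylinder of an even
    word, it would be bounded below over all intervals, contradicting the
    Lebesgue point y. *)
Lemma concentrating_word y (delta : R) : I01 y ->
  lebesgue_pt (fun x => Re (phase h x)) y -> lebesgue_pt (fun x => Im (phase h x)) y ->
  0 < delta -> exists s, [/\ ~~ odd (size s), valid_on s 0 1 &
    mass (deviation y) s 0 1 < delta * len s 0 1].
Proof.
move=> Iy Ry Imy d0; apply: contrapT => nE.
have mF := measurable_deviation y; have F0 := deviation_ge0 y; have FK := deviation_le4 y.
have H s : ~~ odd (size s) -> valid_on s 0 1 ->
    delta * len s 0 1 <= mass (deviation y) s 0 1.
  by move=> es vs; rewrite leNgt; apply/negP => lt; apply: nE; exists s.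
have [k k0 Hk] := even_words_suffice q1 mF F0 FK (ltW d0) H.
have kd0 : 0 < k * delta by rewrite mulr_gt0.
have q1p : 0 < q + 1 by rewrite addr_gt0.
have qm : 0 < q - 1 by rewrite subr_gt0.
(* Twice this oscillation, one for each part of the phase, is half of the lower
   bound provided by [interval_lower_bound]. *)
pose e := (q - 1) * (k * delta) / (256 * (q + 1)).
have e0 : 0 < e by rewrite divr_gt0 ?mulr_gt0.
have /I01E/andP[y0 y1] := Iy.
have H1 := lebesgue_pt_small Ry e0; have H2 := lebesgue_pt_small Imy e0.
have [r [r0 ry ry1 B1 B2]] : exists r, [/\ 0 < r, r < y, r < 1 - y,
    (\int[mu]_(x in `](y - r)%R, (y + r)%R[)
       `|(Re (phase h x) - Re (phase h y))%R|%:E <= (e * (r *+ 2))%:E)%E &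
    (\int[mu]_(x in `](y - r)%R, (y + r)%R[)
       `|(Im (phase h x) - Im (phase h y))%R|%:E <= (e * (r *+ 2))%:E)%E].
  suff : \forall r \near (0 : R)^'+, [/\ 0 < r, r < y, r < 1 - y,
    (\int[mu]_(x in `](y - r)%R, (y + r)%R[)
       `|(Re (phase h x) - Re (phase h y))%R|%:E <= (e * (r *+ 2))%:E)%E &
    (\int[mu]_(x in `](y - r)%R, (y + r)%R[)
       `|(Im (phase h x) - Im (phase h y))%R|%:E <= (e * (r *+ 2))%:E)%E].
    by move=> /filter_ex[r Hr]; exists r.
  near=> r; split.
  - by near: r; exact: nbhs_right_gt.
  - by near: r; exact: nbhs_right_lt.
  - by near: r; apply: nbhs_right_lt; rewrite subr_gt0.
  - by near: r.
  - by near: r.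
have a0 : 0 <= y - r by lra.
have ab : y - r < y + r by lra.
have b1 : y + r <= 1 by lra.
have low := interval_lower_bound q1 mF F0 FK (ltW kd0) Hk a0 ab b1.
have up : mass (deviation y) [::] (y - r) (y + r) <= 2 * (e * (r *+ 2)).
  rewrite -lee_fin (mass_fineK q0 mF F0 FK)//=.
  under eq_integral do rewrite mul1r EFinD.
  have m1 : measurable_fun (`](y - r)%R, (y + r)%R[%classic : set R)
      (fun x => `|Re (phase h x) - Re (phase h y)|%:E).
    apply/measurable_EFinP; apply: measurable_funTS; apply: measurableT_comp => //.
    by apply: measurable_funB; [exact: measurable_Re_phase|exact: measurable_cst].
  have m2 : measurable_fun (`](y - r)%R, (y + r)%R[%classic : set R)
      (fun x => `|Im (phase h x) - Im (phase h y)|%:E).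
    apply/measurable_EFinP; apply: measurable_funTS; apply: measurableT_comp => //.
    by apply: measurable_funB; [exact: measurable_Im_phase|exact: measurable_cst].
  rewrite ge0_integralD//.
  by rewrite mulr2n mulrDl mul1r EFinD leeD.
have : (q - 1) * (k * delta) * (y + r - (y - r)) <= 64 * (q + 1) * (2 * (e * (r *+ 2))).
  by apply: le_trans low _; rewrite ler_wpM2l// mulr_ge0// ltW.
rewrite (_ : y + r - (y - r) = r *+ 2); last by rewrite mulr2n; ring.
rewrite (_ : 64 * (q + 1) * (2 * (e * (r *+ 2))) =
    (q - 1) * (k * delta) * (r *+ 2) / 2); last first.
  by rewrite /e; field; rewrite gt_eqF.
have : 0 < (q - 1) * (k * delta) * (r *+ 2) by rewrite !mulr_gt0// mulrn_wgt0.
lra.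
Unshelve. all: by end_near. Qed.

(** On the cylinder of a concentrating word the phase is close in mean to the phase
    at y, and along the word it is the phase on (0,1) up to a constant.  Replacing
    the weight of the word by its least value costs the factor 4, and another
    factor 2 takes care of the zeros of [h]; together they are the 8 below. *)
Lemma phase_approx (e : R) : 0 < e -> exists k : R[i],
  (\int[mu]_(x in I01) `|(Re (phase h x) - Re k)%R|%:E <= e%:E)%E /\
  (\int[mu]_(x in I01) `|(Im (phase h x) - Im k)%R|%:E <= e%:E)%E.
Proof.
move=> e0; have [y [Iy hy Ry Imy]] := regular_point.
have d0 : 0 < e / 8 by rewrite divr_gt0.
have [s [es vs ms]] := concentrating_word Iy Ry Imy d0.
have s0 : pos s by exact: valid_on_pos vs.
have [c c1 rel] := word_relation q1 Lh z1 e1 l1 hQ es.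
have w1 : 0 < wt s 1 by rewrite word_weight_gt0.
have mF := measurable_deviation y; have F0 := deviation_ge0 y; have FK := deviation_le4 y.
pose k := c * phase h y; exists k.
have near_k : {ae mu, forall x, I01 x ->
    cabs (phase h x - k) <= 2 / wt s 1 * (wt s x * deviation y (psi s x))}.
  apply: ae_imply rel => x relx Ix; have /I01E/andP[x0 x1] := Ix.
  have vx : valid s x by exact: vs.
  have Ip := word_map_I01 vx Ix.
  have F0' := F0 (psi s x).
  apply: (@le_trans _ _ (2 * deviation y (psi s x))); last first.
    rewrite mulrA ler_wpM2r// mulrAC ler_pdivlMr// ler_pM2l//.
    by apply: word_weight_decr => //; exact: ltW.
  (* At zeros of [h] there is no phase relation, but the deviation is at least 1
     there, while two phases differ by at most 2. *)
  have [hp|hp] := eqVneq (h (psi s x)) 0.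
    have dev1 : 1 <= deviation y (psi s x).
      apply: le_trans (cabs_le_deviation _ _).
      rewrite phaseE// hp csign0 sub0r -lecR cabsE normrN phaseE// normr_csign//.
    apply: (@le_trans _ _ (1 + 1)); last by lra.
    apply: le_trans (ler_cabsD _ _) _; apply: lerD; first exact: cabs_csign.
    have -> : cabs (- k) = cabs k by rewrite /cabs normrN.
    by rewrite /k cabs_unit// cabs_csign.
  have hE : phase h x - k = c * (phase h (psi s x) - phase h y).
    by rewrite mulrBr phaseE// (relx Ix vx hp) phaseE.
  rewrite hE cabs_unit//; apply: le_trans (cabs_le_deviation _ _) _; lra.
have bound : (\int[mu]_(x in I01) (2 / wt s 1 * (wt s x * deviation y (psi s x)))%:E <= e%:E)%E.
  under eq_integral do rewrite EFinM.
  rewrite ge0_integralZl_EFin//; last 3 first.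
  - by move=> x /I01E/andP[x0 _]; rewrite lee_fin mulr_ge0// ltW// word_weight_gt0// ltW.
  - exact: (measurable_mass_integrand q0 mF).
  - by rewrite divr_ge0// ltW.
  rewrite -(mass_fineK q0 mF F0 FK)// -EFinM lee_fin.
  have lenw := len_le q1 s0 (lexx 0) ler01; rewrite subr0 mulr1 in lenw.
  have wd := word_weight_distortion q0 s0.
  rewrite mulrAC ler_pdivrMr//.
  have : e / 8 * len s 0 1 <= e / 8 * (4 * wt s 1).
    by rewrite ler_pM2l//; exact: le_trans wd.
  move: ms; lra.
have mbound : measurable_fun (I01 : set R)
    (fun x => (2 / wt s 1 * (wt s x * deviation y (psi s x)))%:E).
  have /measurable_EFinP mm := @measurable_mass_integrand _ _ q0 _ mF s 0 1 s0 (lexx 0).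
  by apply/measurable_EFinP; apply: measurable_funM => //; exact: measurable_cst.
have bound0 x : I01 x -> (0 <= (2 / wt s 1 * (wt s x * deviation y (psi s x)))%:E)%E.
  move=> /I01E/andP[x0 _]; rewrite lee_fin !mulr_ge0 ?invr_ge0 ?(ltW w1)//.
  by rewrite ltW// word_weight_gt0// ltW.
split; apply: le_trans bound; apply: ae_ge0_le_integral => //.
- apply/measurable_EFinP; apply: measurable_funTS; apply: measurableT_comp => //.
  by apply: measurable_funB; [exact: measurable_Re_phase|exact: measurable_cst].
- apply: ae_imply near_k => x nx Ix; rewrite lee_fin; apply: le_trans (nx Ix).
  by rewrite -Re_sub normRe_cabs.
- apply/measurable_EFinP; apply: measurable_funTS; apply: measurableT_comp => //.
  by apply: measurable_funB; [exact: measurable_Im_phase|exact: measurable_cst].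
- apply: ae_imply near_k => x nx Ix; rewrite lee_fin; apply: le_trans (nx Ix).
  by rewrite -Im_sub normIm_cabs.
Qed.

Let not_null (P : R -> Prop) : {ae mu, forall x, I01 x -> P x} -> exists x, I01 x /\ P x.
Proof.
move=> HP; apply: contrapT => nE; have : mu.-negligible (I01 : set R).
  apply: negligibleS HP => x Ix /= H; apply: nE; exists x; split => //.
  exact: H.
move/(measure_negligible mIR) => /= /eqP.
by rewrite /I01 lebesgue_measure_itv/= lte01 oppr0 adde0 onee_eq0.
Qed.

Lemma phase_constant : exists2 c : R[i], `|c| = 1 &
  {ae mu, forall x, I01 x -> csign (h x) = c}.
Proof.
have [a Ha] : exists a, {ae mu, forall x, I01 x -> Re (phase h x) = a}.
  apply: ae_constant_of_approx.
  - by apply: measurable_funTS; exact: measurable_Re_phase.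
  - exact: Re_phase_le.
  - by move=> e /phase_approx[k [Hk _]]; exists (Re k).
have [b Hb] : exists b, {ae mu, forall x, I01 x -> Im (phase h x) = b}.
  apply: ae_constant_of_approx.
  - by apply: measurable_funTS; exact: measurable_Im_phase.
  - exact: Im_phase_le.
  - by move=> e /phase_approx[k [_ Hk]]; exists (Im k).
have H : {ae mu, forall x, I01 x -> csign (h x) = a +i* b}.
  apply: ae_imply2 Ha Hb => x hx hx' Ix.
  by rewrite -phaseE//; move: (hx Ix) (hx' Ix); case: (phase h x) => u v /= -> ->.
exists (a +i* b) => //; apply: contrapT => n1; apply: hN0.
apply: ae_imply H => x hx Ix; apply: contrapT => /eqP h0; apply: n1.
by rewrite -(hx Ix) normr_csign.
Qed.

(** A constant phase cancels in the phase relation, which leaves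
    lambda = zeta^m eta^n for every pair of branches starting inside (0,1), in
    particular for all large m and n; consecutive values give zeta = eta = 1. *)
Lemma trivial_characters : (zeta, eta, lambda) = (1, 1, 1).
Proof.
have [c c1 Hc] := phase_constant.
have c0 : c != 0 by rewrite -normr_eq0 c1 oner_neq0.
have [N N0 /andP[_ qN]] := nat_ceil q1.
have small n x : (N <= n)%N -> 0 < x -> br n.+1 x < 1.
  move=> Nn x0; have n0 : 0 < n.+1%:R + x by rewrite addr_gt0.
  rewrite /branch ltr_pdivrMr// mul1r (le_lt_trans qN)//.
  rewrite (@le_lt_trans _ _ n.+1%:R) ?ler_nat//.
  by rewrite ltrDl.
have Hc2 := ae_branch q1 (ae_branch q1 Hc).
have [x [Ix [[hx Hx] rx]]] : exists x, I01 x /\ ((csign (h x) = c /\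
    (forall n, br n.+1 x < 1 -> forall m, br m.+1 (br n.+1 x) < 1 ->
       csign (h (br m.+1 (br n.+1 x))) = c)) /\
    (forall m n,
       br m.+1 x < 1 -> br n.+1 (br m.+1 x) < 1 -> h (br n.+1 (br m.+1 x)) != 0 ->
       lambda * csign (h x) =
         zeta ^+ m.+1 * eta ^+ n.+1 * csign (h (br n.+1 (br m.+1 x))))).
  apply: not_null.
  have Hcc : {ae mu, forall x, (I01 x -> csign (h x) = c) /\ (I01 x ->
      forall n, br n.+1 x < 1 -> forall m, br m.+1 (br n.+1 x) < 1 ->
      csign (h (br m.+1 (br n.+1 x))) = c)} by exact: ae_imply2 Hc Hc2.
  apply: ae_imply2 Hcc (phase_relation q1 Lh z1 e1 l1 hQ) => x [H1 H2] H3 Ix.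
  by split; [split; [exact: H1|exact: H2]|exact: H3].
have /I01E/andP[x0 x1] := Ix.
have key m n : (N <= m)%N -> (N <= n)%N -> lambda = zeta ^+ m.+1 * eta ^+ n.+1.
  move=> Nm Nn; have y1 := small m x Nm x0.
  have y0 : 0 < br m.+1 x by rewrite branch_gt0 ?ltW.
  have zz1 := small n _ Nn y0.
  have cz := Hx m y1 n zz1.
  have hz : h (br n.+1 (br m.+1 x)) != 0 by rewrite -csign_eq0 cz.
  by have := rx m n y1 zz1 hz; rewrite cz hx => /(mulIf c0).
have zX n : zeta ^+ n != 0 by rewrite expf_neq0// -normr_eq0 z1 oner_neq0.
have eX n : eta ^+ n != 0 by rewrite expf_neq0// -normr_eq0 e1 oner_neq0.
have lE := key N N (leqnn _) (leqnn _).
have eta1 : eta = 1.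
  have := key N N.+1 (leqnn _) (leqnSn _); rewrite lE => /(mulfI (zX _)).
  by rewrite [eta ^+ N.+2]exprS -[LHS]mul1r => /(mulIf (eX _)).
have zeta1 : zeta = 1.
  have := key N.+1 N (leqnSn _) (leqnn _); rewrite lE => /(mulIf (eX _)).
  by rewrite [zeta ^+ N.+2]exprS -[LHS]mul1r => /(mulIf (zX _)).
by rewrite lE eta1 zeta1 !expr1n mulr1.
Qed.

End phase_constant.

(** * Linearity almost everywhere *)

Section linearity.
Context {R : realType} (q : R).
Hypothesis q1 : 1 < q.
Let q0 : 0 < q. Proof. exact: lt_trans q1. Qed.
Local Notation mu := (@lebesgue_measure R).
Local Notation br := (branch q).
Local Notation ext := (patch (fun=> 0) I01).
Implicit Types (w a b : R[i]) (G H : R -> R[i]).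

Let mIR : measurable (I01 : set (measurableTypeR R)). Proof. exact: measurable_itv. Qed.

Lemma ae_transfer w G H : ae01 G H -> ae01 (transfer w q G) (transfer w q H).
Proof.
move=> GH; have := ae_branch q1 (GH : {ae mu, forall x, I01 x -> G x = H x}).
apply: ae_imply => x GHx Ix; rewrite /transfer.
apply: (congr1 (fun f : nat -> R[i]^o => lim (f @ \oo))).
apply/funext => N; apply: eq_big_nat => -[//|n] _.
congr (_ * _); rewrite /patch; case: ifPn => // /set_mem/I01E/andP[_ bx].
exact: GHx.
Qed.

Lemma transfer_to_lin w a b G H K (y : R) s t :
  (forall n, ext K (br n.+1 y) = a * ext G (br n.+1 y) + b * ext H (br n.+1 y)) ->
  transfer_to q w G y s -> transfer_to q w H y t ->
  transfer_to q w K y (a * s + b * t).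
Proof.
move=> KE Gs Ht; rewrite /transfer_to.
have -> : (fun n => \sum_(k < n) transfer_term q w K y k : R[i]^o) =
    (fun n => a *: (\sum_(k < n) transfer_term q w G y k : R[i]^o) +
              b *: (\sum_(k < n) transfer_term q w H y k : R[i]^o)).
  apply/funext => n; rewrite /GRing.scale/= !mulr_sumr -big_split/=.
  by apply: eq_bigr => k _; rewrite /transfer_term KE; ring.
by apply: cvgD; apply: cvgZr.
Qed.

Lemma L1_lin a b G H : L1 G -> L1 H -> L1 (fun x => a * G x + b * H x).
Proof.
move=> [Gr Gi] [Hr Hi].
have lin (c1 c2 c3 c4 : R) : mu.-integrable I01 (fun x =>
    (c1 * complex.Re (G x) + c2 * complex.Im (G x) +
     (c3 * complex.Re (H x) + c4 * complex.Im (H x)))%:E).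
  exact: (integrableD mIR
    (integrableD mIR (integrableZl mIR c1 Gr) (integrableZl mIR c2 Gi))
    (integrableD mIR (integrableZl mIR c3 Hr) (integrableZl mIR c4 Hi))).
split.
- apply: eq_integrable
    (lin (complex.Re a) (- complex.Im a) (complex.Re b) (- complex.Im b)) => // x _.
  by congr EFin; case: a b (G x) (H x) => [? ?] [? ?] [? ?] [? ?] /=; ring.
- apply: eq_integrable
    (lin (complex.Im a) (complex.Re a) (complex.Im b) (complex.Re b)) => // x _.
  by congr EFin; case: a b (G x) (H x) => [? ?] [? ?] [? ?] [? ?] /=; ring.
Qed.

(** Linearity needs convergence of the outer series and of the inner series at all
    points that the outer one visits.  Both hold where the twice iterated
    Perron-Frobenius operator is finite on the two moduli. *)
Lemma ae_Q_lin (zeta eta : R[i]) a b G H : `|zeta| = 1 -> `|eta| = 1 ->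
  L1 G -> L1 H ->
  ae01 (Q q zeta eta (fun x => a * G x + b * H x))
       (fun x => a * Q q zeta eta G x + b * Q q zeta eta H x).
Proof.
move=> z1 e1 LG LH.
apply: ae_imply2 (ae_pf_pf_lty q1 LG) (ae_pf_pf_lty q1 LH) => x Gx Hx Ix.
have {}Gx := Gx Ix; have {}Hx := Hx Ix.
have [QG _ _] := Q_modulus_bound q1 z1 e1 Ix Gx.
have [QH _ _] := Q_modulus_bound q1 z1 e1 Ix Hx.
apply: transfer_toE; apply: transfer_to_lin QG QH => n; rewrite /patch.
case: ifPn => [/set_mem Iy|_]; last by rewrite !mulr0 addr0.
have pf0 M z : (0 <= perron_frobenius q (modulus M) z)%E.
  by apply: pf_ge0 => // ?; exact: modulus_ge0.
have [TG _ _] :=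
  transfer_modulus_bound q1 e1 Iy (pf_branch_lty q1 n (pf0 G) Ix Gx).
have [TH _ _] :=
  transfer_modulus_bound q1 e1 Iy (pf_branch_lty q1 n (pf0 H) Ix Hx).
apply: transfer_toE; apply: transfer_to_lin TG TH => k; rewrite /patch.
by case: ifPn => // _; rewrite !mulr0 addr0.
Qed.

Lemma transfer0 w (x : R) : transfer w q (fun=> 0) x = 0.
Proof.
apply: transfer_toE; rewrite /transfer_to.
have -> : (fun n => \sum_(k < n) transfer_term q w (fun=> 0) x k : R[i]^o) = cst 0.
  apply/funext => n; apply: big1 => k _; rewrite /transfer_term /patch.
  by case: ifP => _; rewrite mulr0.
exact: cvg_cst.
Qed.

Lemma ae01_trans (V : Type) (f g k : R -> V) : ae01 f g -> ae01 g k -> ae01 f k.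
Proof. by move=> fg gk; apply: ae_imply2 fg gk => x fgx gkx Ix; rewrite fgx// gkx. Qed.

End linearity.

(** * The kernel of Q - lambda *)

Section kernel.
Context {R : realType} (q : R).
Hypothesis q1 : 1 < q.

Lemma kerQ_trivial (zeta eta lambda : R[i]) : `|zeta| = 1 -> `|eta| = 1 -> `|lambda| = 1 ->
  (zeta, eta, lambda) <> (1, 1, 1) -> kerQ q zeta eta lambda = L1zero.
Proof.
move=> z1 e1 l1 n1; apply/seteqP; split => h [Lh hh]; split => //.
  by apply: contrapT => hN0; apply: n1; exact: (trivial_characters q1 Lh z1 e1 l1 hh).
have Q0 : ae01 (Q q zeta eta h) (fun=> 0).
  have T0 : ae01 (transfer eta q h) (fun=> 0).
    apply: ae01_trans (ae_transfer q1 eta hh) _.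
    by apply: aeW => x _; exact: transfer0.
  apply: ae01_trans (ae_transfer q1 zeta T0) _.
  by apply: aeW => x _; exact: transfer0.
apply: ae_imply2 Q0 hh => x Qx hx Ix.
by rewrite (Qx Ix) (hx Ix) mulr0 subrr.
Qed.

End kernel.

Section fixed_density.
Context {R : realType} (q : R).
Hypothesis q1 : 1 < q.
Local Notation mu := (@lebesgue_measure R).
Local Notation Re := (@complex.Re R).
Local Notation Im := (@complex.Im R).

Let mI : measurable (I01 : set R). Proof. exact: measurable_itv. Qed.
Let mIR : measurable (I01 : set (measurableTypeR R)). Proof. exact: measurable_itv. Qed.

(** With constant phase c, the integral of [h] is c times that of its modulus, and
    one of the two parts of c is not zero. *)
Lemma ae_zero_of_integral_zero (h : R -> R[i]) (zeta eta lambda : R[i]) :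
  `|zeta| = 1 -> `|eta| = 1 -> `|lambda| = 1 ->
  L1 h -> ae01 (fun x => Q q zeta eta h x - lambda * h x) (fun=> 0) ->
  (\int[mu]_(x in I01) (Re (h x))%:E = 0)%E ->
  (\int[mu]_(x in I01) (Im (h x))%:E = 0)%E -> ae01 h (fun=> 0).
Proof.
move=> z1 e1 l1 Lh hQ Re0 Im0; apply: contrapT => hN0.
have [c c1 Hc] := phase_constant q1 Lh z1 e1 l1 hQ hN0.
apply: hN0.
have hE : {ae mu, forall x, I01 x -> h x = (cabs (h x))%:C * c}.
  by apply: ae_imply Hc => x hx Ix; rewrite -(hx Ix) csignE.
have mm : measurable_fun (I01 : set (measurableTypeR R)) (modulus h).
  by apply: measurable_funTS; exact: measurable_modulus.
have im : mu.-integrable I01 (modulus h).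
  apply/integrableP; split => //.
  under eq_integral do rewrite gee0_abs ?modulus_ge0//.
  exact: integral_modulus_lty.
have part (k : R) (P : R[i] -> R) : P c = k -> (forall (r : R), P (r%:C * c) = k * r) ->
    measurable_fun (I01 : set (measurableTypeR R)) (fun x => (P (h x))%:E) ->
    (\int[mu]_(x in I01) (P (h x))%:E = 0)%E ->
    k != 0 -> (\int[mu]_(x in I01) modulus h x = 0)%E.
  move=> Pc PZ mP P0 k0.
  have : (\int[mu]_(x in I01) (k%:E * modulus h x) = 0)%E.
    rewrite -P0; apply: ae_eq_integral => //.
      exact: measurable_funeM.
    apply: ae_imply hE => x hx Ix.
    by rewrite modulusE// -EFinM [in RHS](hx Ix) PZ.
  rewrite integralZl// => /eqP; rewrite mule_eq0 => /orP[|/eqP//].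
  by rewrite eqe (negbTE k0).
have int0 : (\int[mu]_(x in I01) modulus h x = 0)%E.
  have [/integrableP[mr _] /integrableP[mi _]] := Lh.
  have [c0|c0] := eqVneq (Re c) 0.
    apply: (part (Im c) Im) => //.
      by move=> r; case: (c) => u v /=; ring.
    apply/eqP => c0'; move: c1; rewrite (_ : c = 0) ?normr0.
      by move/eqP; rewrite eq_sym oner_eq0.
    by apply/eqP; rewrite eq_complex c0 c0'/= eqxx.
  apply: (part (Re c) Re) => //.
  by move=> r; case: (c) => u v /=; ring.
have : (\int[mu]_(x in I01) `|modulus h x| = 0)%E.
  by under eq_integral do rewrite gee0_abs ?modulus_ge0//.
move=> /(ae_eq_integral_abs _ mIR mm).
apply: ae_imply => x hx Ix; move: (hx Ix); rewrite modulusE// => -[] /eqP.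
by rewrite cabs_eq0 => /eqP.
Qed.

Variable rho : R -> R.
Hypotheses (irho : mu.-integrable I01 (fun x => (rho x)%:E))
  (rho_fixed : ae01 (transfer 1 q (fun x => (rho x)%:C)) (fun x => (rho x)%:C))
  (rho1 : (\int[mu]_(x in I01) (rho x)%:E = 1)%E).

Let Lrho : L1 (fun x => (rho x)%:C).
Proof. by split => //=; exact: integrable0. Qed.

Let one : `|1 : R[i]| = 1. Proof. exact: normr1. Qed.

Let Q_rho : ae01 (Q q 1 1 (fun x => (rho x)%:C)) (fun x => (rho x)%:C).
Proof. by apply: ae01_trans rho_fixed; exact: ae_transfer. Qed.

(** Subtracting from an eigenfunction its integral times rho gives an eigenfunction
    of integral zero. *)
Lemma kerQ_rho : kerQ q 1 1 1 = Cspan (fun x => (rho x)%:C).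
Proof.
apply/seteqP; split => h [Lh hh]; split => //.
- have [ir ii] := Lh.
  pose t : R[i] := fine (\int[mu]_(x in I01) (Re (h x))%:E)%E
    +i* fine (\int[mu]_(x in I01) (Im (h x))%:E)%E.
  pose h' x := 1 * h x + (- t) * (rho x)%:C.
  have Lh' : L1 h' by exact: L1_lin.
  have h'Q : ae01 (fun x => Q q 1 1 h' x - 1 * h' x) (fun=> 0).
    have H : {ae mu, forall x, (I01 x -> Q q 1 1 h x = h x) /\
        (I01 x -> Q q 1 1 (fun x => (rho x)%:C) x = (rho x)%:C)}.
      apply: ae_imply2 hh Q_rho => x hx rx; split => // Ix.
      by have /subr0_eq := hx Ix; rewrite mul1r.
    apply: ae_imply2 (ae_Q_lin q1 1 (- t) one one Lh Lrho) H => x lin [Qh Qr] Ix.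
    by rewrite (lin Ix) (Qh Ix) (Qr Ix) /h'; ring.
  have int0 (g : R -> R) : mu.-integrable I01 (fun x => (g x)%:E) ->
      (\int[mu]_(x in I01) (g x - fine (\int[mu]_(x in I01) (g x)%:E)%E * rho x)%:E = 0)%E.
    move=> ig; set k := fine _.
    have ikr := integrableZl mIR k irho.
    under eq_integral do rewrite EFinB EFinM.
    rewrite integralB// integralZl// rho1 mule1 /k fineK ?subee//;
      exact: integrable_fin_num.
  exists t; have := ae_zero_of_integral_zero one one one Lh' h'Q.
  move=> H; apply: ae_imply (H _ _) => [x h'0 Ix||].
  + have := h'0 Ix; rewrite /h' mul1r mulNr => /subr0_eq -> //.
  + rewrite -[RHS](int0 _ ir); apply: eq_integral => x _; congr EFin.
    by rewrite /h' /t; case: (h x) => u v /=; ring.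
  + rewrite -[RHS](int0 _ ii); apply: eq_integral => x _; congr EFin.
    by rewrite /h' /t; case: (h x) => u v /=; ring.
- case: hh => c hc.
  have hc' : ae01 h (fun x => c * (rho x)%:C + 0 * (rho x)%:C).
    by apply: ae_imply hc => x hx Ix; rewrite hx// mul0r addr0.
  have Qh : ae01 (Q q 1 1 h) (Q q 1 1 (fun x => c * (rho x)%:C + 0 * (rho x)%:C)).
    by do 2 apply: ae_transfer => //.
  have H : {ae mu, forall x, (I01 x -> h x = c * (rho x)%:C) /\
      (I01 x -> Q q 1 1 (fun x => (rho x)%:C) x = (rho x)%:C)}.
    by apply: ae_imply2 hc Q_rho.
  have := ae01_trans Qh (ae_Q_lin q1 c 0 one one Lrho Lrho).
  move=> H'; apply: ae_imply2 H' H => x Qx [hx rx] Ix.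
  by rewrite (Qx Ix) (hx Ix) (rx Ix); ring.
Qed.

End fixed_density.

Theorem proposition4p6 (R : realType) (q : R) (zeta eta lambda : R[i])
    (hq : 1 < q) (hzeta : `|zeta| = 1) (heta : `|eta| = 1)
    (hlambda : `|lambda| = 1) :
  ((zeta, eta, lambda) = (1, 1, 1) ->
     forall rho : R -> R, is_rho q rho ->
       kerQ q zeta eta lambda = Cspan (fun x => (rho x)%:C)) /\
  ((zeta, eta, lambda) <> (1, 1, 1) -> kerQ q zeta eta lambda = L1zero).
Proof.
split; last exact: kerQ_trivial.
by move=> [-> -> ->] rho [irho _ rho_fixed _ rho1]; exact: kerQ_rho.
Qed.
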